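(* Consider the plant $\dot x = Ax+Bu+B_w w$, $z = Cx+Du+D_w w$ with $A$ Hurwitz and constant $w\in\mathcal{W}$, and let all the problem data be as in the context, satisfying the standing assumptions listed there. Let $\rho>0$ and $\gamma>0$, and let the matrices $\mathcal{A},\mathcal{B},\mathcal{B}_1,\mathcal{B}_2,\mathcal{C}_1,\mathcal{E}_1,\mathcal{D}_1,\mathcal{D}_{12},\mathcal{C}_2,\mathcal{E}_2,\mathcal{D}_{21},\mathcal{D}_2$ and the multipliers $\Theta_1,\Theta_2$ be as defined in the context. Suppose that there exist $Y\succ0$, $Z\in\mathbb{R}^{m\times(q+n_{\rm c})}$ and $\theta_1,\theta_2>0$ such that, with $\Theta=\mathrm{daug}(\Theta_1/\theta_1,\Theta_2/\theta_2)$, $$M^{\mathsf T}\begin{bmatrix}0&-I_{q+n_{\rm c}}&0&0&0\\ -I_{q+n_{\rm c}}&0&0&0&0\\ 0&0&-\Theta^{-1}&0&0\\ 0&0&0&I_{n_w}&0\\ 0&0&0&0&-\gamma^2I_{q+n_{\rm c}}\end{bmatrix}M\prec0,$$ where $$M=\begin{bmatrix}-(\mathcal{A}Y+\mathcal{B}Z)^{\mathsf T}&-(\mathcal{C}_1Y+\mathcal{E}_1Z)^{\mathsf T}&-(\mathcal{C}_2Y+\mathcal{E}_2Z)^{\mathsf T}\\ I_{q+n_{\rm c}}&0&0\\ -\mathcal{B}_1^{\mathsf T}&-\mathcal{D}_1^{\mathsf T}&-\mathcal{D}_{21}^{\mathsf T}\\ 0&I_{m+r}&0\\ -\mathcal{B}_2^{\mathsf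 T}&-\mathcal{D}_{12}^{\mathsf T}&-\mathcal{D}_2^{\mathsf T}\\ 0&0&I_{q+n_{\rm c}}\end{bmatrix},$$ and set $K=\begin{bmatrix}K_1&K_2\end{bmatrix}=ZY^{-1}$ with $K_1\in\mathbb{R}^{m\times q}$, $K_2\in\mathbb{R}^{m\times n_{\rm c}}$. Then there exists $\tau^\star>0$ such that for all $\tau>\tau^\star$ the controller $$\tau\dot\eta_1=-T_u^{\mathsf T}\nabla f_0(u)-T_z^{\mathsf T}\nabla g_0(z),\qquad \tau\dot\eta_2=-(H_zz+H_uu+H_ww),\qquad u=K_1\eta_1+K_2\eta_2$$ solves the OSS control problem.
   Context: Plant: $x(t)\in\mathbb{R}^n$ is the state, $z(t)\in\mathbb{R}^r$ the measured output, $u(t)\in\mathbb{R}^m$ the control input, and $w\in\mathcal{W}\subset\mathbb{R}^{n_w}$ a constant exogenous signal: $\dot x = Ax+Bu+B_ww$, $z=Cx+Du+D_ww$, with $A$ Hurwitz. The DC gain matrices are $G_u=-CA^{-1}B+D\in\mathbb{R}^{r\times m}$ and $G_w=-CA^{-1}B_w+D_w\in\mathbb{R}^{r\times n_w}$, so that at equilibrium $\bar z=G_u\bar u+G_ww$. Steady-state optimization problem (for given $w$): $$\text{minimize}_{\bar z,\bar u}\ f_0(\bar u)+g_0(\bar z)\quad\text{subject to}\quad \bar z=G_u\bar u+G_ww,\quad 0=H_z\bar z+H_u\bar u+H_ww,$$ where $H_z\in\mathbb{R}^{n_{\rm c}\times r}$, $H_u\in\mathbb{R}^{n_{\rm c}\times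 m}$, $H_w\in\mathbb{R}^{n_{\rm c}\times n_w}$, and $f_0$, $g_0$ are convex cost functions defined on closed non-empty convex sets $\mathcal{U}\subseteq\mathbb{R}^m$ and $\mathcal{Z}\subseteq\mathbb{R}^r$ respectively. They may contain barrier terms, so they are finite on the interiors of their domains and may take the value $+\infty$ on the boundary. OSS (optimal steady-state) control problem: a controller solves it if, for each $w\in\mathcal{W}$, the closed-loop system of plant and controller possesses a unique locally exponentially stable equilibrium point, and the corresponding equilibrium pair $(\bar u,\bar z)$ is an optimal point of the optimization problem above. Standing assumptions: on the interiors of their domains, $f_0$ and $g_0$ are convex, continuously differentiable, and have at least locally Lipschitz continuous gradients; $\mathcal{W}$ is convex and compact; the optimization problem is strictly feasible and has an optimal solution for all $w\in\mathcal{W}$; both $z(t)$ and $H_zz(t)+H_uu(t)+H_ww$ are measurable (available to the controller). Matrix $T$: $T=\begin{bmatrix}T_z\\ T_u\end{bmatrix}\in\mathbb{R}^{(r+m)\times q}$, with $T_z\in\mathbb{R}^{r\times q}$ and $T_u\in\mathbb{R}^{m\times q}$, is a matrix such that $\mathrm{range}(T)=\mathrm{null}\begin{bmatrix}I_r&-G_u\\ H_z&H_u\end{bmatrix}$. The controller states are $\eta_1\in\mathbb{R}^q$, $\eta_2\in\mathbb{R}^{n_{\rm c}}$. Cost splitting: $\nabla f_0(u)=Q_1u+\nabla\tilde f_0(u)$ and $\nabla g_0(z)=Q_2z+\nabla\tilde g_0(z)$ with $Q_1,Q_2\succeq0$ symmetric and $\tilde f_0,\tilde g_0$ convex. Put $\Delta_1=\nabla\tilde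 f_0$, $\Delta_2=\nabla\tilde g_0$. Multipliers: for $i=1,2$, $\Theta_i$ is a symmetric block two-by-two matrix for which the incremental sector constraint $$\begin{bmatrix}\Delta_i(q_i)-\Delta_i(q_i')\\ q_i-q_i'\end{bmatrix}^{\mathsf T}\Theta_i\begin{bmatrix}\Delta_i(q_i)-\Delta_i(q_i')\\ q_i-q_i'\end{bmatrix}\ge0$$ holds for all arguments $q_i,q_i'$, chosen according to the class of the function $\phi_1=\tilde f_0$ (resp. $\phi_2=\tilde g_0$), with $d_1=m$, $d_2=r$: (i) $\phi_i$ convex: $\Theta_i=\begin{bmatrix}0&1\\ 1&0\end{bmatrix}\otimes I_{d_i}$; (ii) $\phi_i$ convex with $L$-Lipschitz gradient ($L>0$): $\Theta_i=\begin{bmatrix}-2&L\\ L&0\end{bmatrix}\otimes I_{d_i}$; (iii) $\phi_i$ strongly convex with parameter $\mu_i>0$: $\Theta_i=\begin{bmatrix}0&1\\ 1&-2\mu_i\end{bmatrix}\otimes I_{d_i}$; (iv) $\phi_i$ strongly convex with parameter $\mu_i>0$ and with $L$-Lipschitz gradient, $L>\mu_i$: $\Theta_i=\begin{bmatrix}-2&\mu_i+L\\ \mu_i+L&-2\mu_iL\end{bmatrix}\otimes I_{d_i}$. The diagonal augmentation of two symmetric block two-by-two matrices is $$\mathrm{daug}\left(\begin{bmatrix}X_1&S_1\\ S_1^{\mathsf T}&R_1\end{bmatrix},\begin{bmatrix}X_2&S_2\\ S_2^{\mathsf T}&R_2\end{bmatrix}\right)=\begin{bmatrix}X_1&0&S_1&0\\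 0&X_2&0&S_2\\ S_1^{\mathsf T}&0&R_1&0\\ 0&S_2^{\mathsf T}&0&R_2\end{bmatrix}.$$ System matrices: let $N=H_zG_u+H_u$, $\tilde N=H_zG_w+H_w$, $Q=T_u^{\mathsf T}Q_1+T_z^{\mathsf T}Q_2G_u$. Then $$\mathcal{A}=0\in\mathbb{R}^{(q+n_{\rm c})\times(q+n_{\rm c})},\quad \mathcal{B}=\begin{bmatrix}-Q\\ -N\end{bmatrix},\quad \mathcal{B}_1=\begin{bmatrix}-T_u^{\mathsf T}&-T_z^{\mathsf T}\\ 0&0\end{bmatrix},\quad \mathcal{B}_2=\begin{bmatrix}-T_z^{\mathsf T}Q_2G_w\\ -\tilde N\end{bmatrix},$$ $$\mathcal{C}_1=0\in\mathbb{R}^{(m+r)\times(q+n_{\rm c})},\quad \mathcal{E}_1=\begin{bmatrix}I_m\\ G_u\end{bmatrix},\quad \mathcal{D}_1=0\in\mathbb{R}^{(m+r)\times(m+r)},\quad \mathcal{D}_{12}=\begin{bmatrix}0\\ G_w\end{bmatrix},$$ $$\mathcal{C}_2=0\in\mathbb{R}^{(q+n_{\rm c})\times(q+n_{\rm c})},\quad \mathcal{E}_2=\begin{bmatrix}-Q\\ -\rho N\end{bmatrix},\quad \mathcal{D}_{21}=\begin{bmatrix}-T_u^{\mathsf T}&-T_z^{\mathsf T}\\ 0&0\end{bmatrix},\quad \mathcal{D}_2=\begin{bmatrix}-T_z^{\mathsf T}Q_2G_w\\ -\rho\tilde N\end{bmatrix}.$$ $X\succ0$ (resp. $X\prec0$)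 means symmetric positive (resp. negative) definite.
   Formalization: The standing assumption that an optimal solution exists for all w is strengthened to: for each w there is an optimal solution with u and z in the interiors of their domains, where the gradients exist; with a boundary optimum the claim can fail. *)

(* Defs.v *)
From HB Require Import structures.
From mathcomp Require Import all_boot all_order all_algebra.
From mathcomp Require Import complex.
From mathcomp Require Import all_classical all_reals all_analysis.

Set Implicit Arguments.
Unset Strict Implicit.
Unset Printing Implicit Defensive.

Import Order.TTheory GRing.Theory Num.Theory.
Import numFieldNormedType.Exports.

Local Open Scope classical_set_scope.
Local Open Scope ring_scope.

(** * Matrices *)

Definition quadform (R : realType) (d : nat) (X : 'M[R]_d) (v : 'cV[R]_d) : R :=
  (v^T *m X *m v) 0 0.

Definition posdef (R : realType) (d : nat) (X : 'M[R]_d) : Prop :=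
  X^T = X /\ forall v : 'cV[R]_d, v != 0 -> 0 < quadform X v.

Definition possemidef (R : realType) (d : nat) (X : 'M[R]_d) : Prop :=
  X^T = X /\ forall v : 'cV[R]_d, 0 <= quadform X v.

Definition negdef (R : realType) (d : nat) (X : 'M[R]_d) : Prop :=
  X^T = X /\ forall v : 'cV[R]_d, v != 0 -> quadform X v < 0.

Definition hurwitz (R : realType) (d : nat) (A : 'M[R]_d) : Prop :=
  forall l : complex R,
    eigenvalue (map_mx (real_complex R) A) l -> complex.Re l < 0.

Definition bdiag (R : realType) (d e : nat) (X : 'M[R]_d) (Y : 'M[R]_e) :
    'M[R]_(d + e) :=
  block_mx X 0 0 Y.

Definition daug (R : realType) (d e : nat)
    (X : 'M[R]_(d + d)) (Y : 'M[R]_(e + e)) : 'M[R]_((d + e) + (d + e)) :=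
  block_mx (bdiag (ulsubmx X) (ulsubmx Y)) (bdiag (ursubmx X) (ursubmx Y))
           (bdiag (dlsubmx X) (dlsubmx Y)) (bdiag (drsubmx X) (drsubmx Y)).

(* The Kronecker product of the 2 x 2 matrix [a b; c e] with the identity
   matrix, written so that its two blocks of coordinates are visible in the
   type. *)
Definition kron2I (R : realType) (d : nat) (a b c e : R) : 'M[R]_(d + d) :=
  block_mx a%:M b%:M c%:M e%:M.

(** * Convex functions and gradients *)

(* The normed-module norm of 'cV[R]_d is the max norm; the Lipschitz and
   strong convexity constants below refer to the Euclidean norm. *)
Definition enorm (R : realType) (d : nat) (x : 'cV[R]_d) : R :=
  Num.sqrt (\sum_(i < d) x i 0 ^+ 2).

Definition grad (R : realType) (d : nat) (f : 'cV[R]_d -> R) (x : 'cV[R]_d) :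
    'cV[R]_d :=
  \col_(i < d) 'D_(delta_mx i 0) f x.

Definition eucl_lipschitz_on (R : realType) (d : nat) (L : R)
    (D : set 'cV[R]_d) (G : 'cV[R]_d -> 'cV[R]_d) : Prop :=
  forall x y, D x -> D y -> enorm (G x - G y) <= L * enorm (x - y).

Definition convex_on (R : realType) (d : nat) (D : set 'cV[R]_d)
    (f : 'cV[R]_d -> R) : Prop :=
  @convex_function R 'cV[R]_d D f.

Definition strongly_convex_on (R : realType) (d : nat) (mu : R)
    (D : set 'cV[R]_d) (f : 'cV[R]_d -> R) : Prop :=
  forall (x y : 'cV[R]_d) (t : R), D x -> D y -> 0 <= t <= 1 ->
    f (t *: x + (1 - t) *: y) <=
      t * f x + (1 - t) * f y - mu / 2 * t * (1 - t) * enorm (x - y) ^+ 2.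

(* A value +oo is allowed; [0 * +oo = 0] makes the end points harmless. *)
Definition econvex_on (R : realType) (d : nat) (D : set 'cV[R]_d)
    (f : 'cV[R]_d -> \bar R) : Prop :=
  forall (x y : 'cV[R]_d) (t : R), D x -> D y -> 0 <= t <= 1 ->
    (f (t *: x + (1 - t) *: y)%R <= t%:E * f x + (1 - t)%:E * f y)%E.

(* A convex cost with domain [D]: finite on the interior of [D], possibly +oo
   on its boundary, and there C^1 with locally Lipschitz gradient.  The values
   of [f] outside [D] are never used. *)
Record convex_cost (R : realType) (d : nat) (D : set 'cV[R]_d)
    (f : 'cV[R]_d -> \bar R) : Prop := ConvexCost {
  cost_dom_closed : closed D;
  cost_dom_nonempty : D !=set0;
  cost_dom_convex : @convex_set R 'cV[R]_d D;
  cost_gtNy : forall x, D x -> f x != -oo%E;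
  cost_fin : forall x, D° x -> f x \is a fin_num;
  cost_convex : econvex_on D f;
  cost_diff : forall x, D° x -> differentiable (fine \o f) x;
  cost_grad_cont : {within D°, continuous (grad (fine \o f))};
  cost_grad_lip : [locally [lipschitz grad (fine \o f) x | x in D°]] }.

Record cost_splitting (R : realType) (d : nat) (D : set 'cV[R]_d)
    (f : 'cV[R]_d -> \bar R) (Q : 'M[R]_d) (phi : 'cV[R]_d -> R) : Prop :=
    CostSplitting {
  split_psd : possemidef Q;
  split_convex : convex_on D° phi;
  split_diff : forall x, D° x -> differentiable phi x;
  split_grad : forall x, D° x -> grad (fine \o f) x = Q *m x + grad phi x }.

(* The multipliers attached to the four classes of functions, for
   [Delta = grad phi] on [D] and the ordering (Delta q - Delta q', q - q'). *)
Inductive class_multiplier (R : realType) (d : nat) (D : set 'cV[R]_d)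
    (phi : 'cV[R]_d -> R) : 'M[R]_(d + d) -> Prop :=
| Mult_convex : convex_on D phi ->
    class_multiplier D phi (kron2I d 0 1 1 0)
| Mult_convex_smooth (L : R) : 0 < L ->
    convex_on D phi -> eucl_lipschitz_on L D (grad phi) ->
    class_multiplier D phi (kron2I d (- 2) L L 0)
| Mult_strong (mu : R) : 0 < mu ->
    strongly_convex_on mu D phi ->
    class_multiplier D phi (kron2I d 0 1 1 (- 2 * mu))
| Mult_strong_smooth (mu L : R) : 0 < mu -> mu < L ->
    strongly_convex_on mu D phi -> eucl_lipschitz_on L D (grad phi) ->
    class_multiplier D phi (kron2I d (- 2) (mu + L) (mu + L) (- 2 * mu * L)).

(** * Autonomous differential equations *)

(* [xi] solves xi' = F xi on [0, T[, staying in the domain [D] of [F];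
   [T] may be +oo. *)
Definition ode_solution (R : realType) (d : nat) (F : 'cV[R]_d -> 'cV[R]_d)
    (D : set 'cV[R]_d) (T : \bar R) (xi : R -> 'cV[R]_d) : Prop :=
  [/\ {within [set t : R | 0 <= t /\ (t%:E < T)%E], continuous xi},
      forall t : R, 0 <= t -> (t%:E < T)%E -> D (xi t)
    & forall t : R, 0 < t -> (t%:E < T)%E -> is_derive t 1 xi (F (xi t))].

Definition equilibrium (R : realType) (d : nat) (F : 'cV[R]_d -> 'cV[R]_d)
    (D : set 'cV[R]_d) (e : 'cV[R]_d) : Prop :=
  D e /\ F e = 0.

(* Near [e], forward solutions exist for all times and every solution, on
   whatever interval, satisfies the exponential bound.  All norms being
   equivalent, the choice of norm only affects [c] and [delta]. *)
Definition locally_exp_stable (R : realType) (d : nat)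
    (F : 'cV[R]_d -> 'cV[R]_d) (D : set 'cV[R]_d) (e : 'cV[R]_d) : Prop :=
  exists delta c lambda : R, [/\ 0 < delta, 0 < c, 0 < lambda &
    forall v : 'cV[R]_d, `|v - e| < delta ->
      (exists xi, ode_solution F D +oo%E xi /\ xi 0 = v) /\
      (forall (T : \bar R) (xi : R -> 'cV[R]_d),
         ode_solution F D T xi -> xi 0 = v ->
         forall t : R, 0 <= t -> (t%:E < T)%E ->
           `|xi t - e| <= c * expR (- lambda * t) * `|v - e|)].

(** * Optimal steady-state control *)

Record plant (R : realType) (n m r nw : nat) := Plant {
  plA : 'M[R]_n; plB : 'M[R]_(n, m); plBw : 'M[R]_(n, nw);
  plC : 'M[R]_(r, n); plD : 'M[R]_(r, m); plDw : 'M[R]_(r, nw) }.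

Definition dcgain_u (R : realType) (n m r nw : nat) (P : plant R n m r nw) :
    'M[R]_(r, m) :=
  - plC P *m invmx (plA P) *m plB P + plD P.

Definition dcgain_w (R : realType) (n m r nw : nat) (P : plant R n m r nw) :
    'M[R]_(r, nw) :=
  - plC P *m invmx (plA P) *m plBw P + plDw P.

Record steady_problem (R : realType) (m r nw nc : nat) := SteadyProblem {
  domU : set 'cV[R]_m; cost_f : 'cV[R]_m -> \bar R;
  domZ : set 'cV[R]_r; cost_g : 'cV[R]_r -> \bar R;
  conHz : 'M[R]_(nc, r); conHu : 'M[R]_(nc, m); conHw : 'M[R]_(nc, nw) }.

Definition con_error (R : realType) (m r nw nc : nat)
    (pb : steady_problem R m r nw nc) (w : 'cV[R]_nw) (z : 'cV[R]_r)
    (u : 'cV[R]_m) : 'cV[R]_nc :=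
  conHz pb *m z + conHu pb *m u + conHw pb *m w.

Definition feasible (R : realType) (n m r nw nc : nat)
    (P : plant R n m r nw) (pb : steady_problem R m r nw nc)
    (w : 'cV[R]_nw) (z : 'cV[R]_r) (u : 'cV[R]_m) : Prop :=
  [/\ domU pb u, domZ pb z, z = dcgain_u P *m u + dcgain_w P *m w
    & 0 = con_error pb w z u].

(* All the constraints other than the domain ones are equalities. *)
Definition strictly_feasible (R : realType) (n m r nw nc : nat)
    (P : plant R n m r nw) (pb : steady_problem R m r nw nc)
    (w : 'cV[R]_nw) (z : 'cV[R]_r) (u : 'cV[R]_m) : Prop :=
  [/\ feasible P pb w z u, (domU pb)° u & (domZ pb)° z].

Definition optimal (R : realType) (n m r nw nc : nat)
    (P : plant R n m r nw) (pb : steady_problem R m r nw nc)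
    (w : 'cV[R]_nw) (z : 'cV[R]_r) (u : 'cV[R]_m) : Prop :=
  feasible P pb w z u /\
  forall z' u', feasible P pb w z' u' ->
    (cost_f pb u + cost_g pb z <= cost_f pb u' + cost_g pb z')%E.

(* A controller with state eta measures z and the constraint error
   e = Hz z + Hu u + Hw w, but not w.  Its right-hand side [ctrl_field] is
   meaningful only for (z, u) in [ctrl_dom] (gradients of the costs exist only
   in the interior of their domains). *)
Record controller (R : realType) (s m r nc : nat) := Controller {
  ctrl_dom : 'cV[R]_r -> 'cV[R]_m -> Prop;
  ctrl_field : 'cV[R]_s -> 'cV[R]_r -> 'cV[R]_m -> 'cV[R]_nc -> 'cV[R]_s;
  ctrl_out : 'cV[R]_s -> 'cV[R]_m }.

(* The closed-loop state is the column (x, eta). *)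
Definition cl_input (R : realType) (n s m r nc : nat)
    (K : controller R s m r nc) (xi : 'cV[R]_(n + s)) : 'cV[R]_m :=
  ctrl_out K (dsubmx xi).

Definition cl_output (R : realType) (n s m r nw nc : nat)
    (P : plant R n m r nw) (K : controller R s m r nc) (w : 'cV[R]_nw)
    (xi : 'cV[R]_(n + s)) : 'cV[R]_r :=
  plC P *m usubmx xi + plD P *m cl_input K xi + plDw P *m w.

Definition cl_dom (R : realType) (n s m r nw nc : nat)
    (P : plant R n m r nw) (K : controller R s m r nc) (w : 'cV[R]_nw) :
    set 'cV[R]_(n + s) :=
  [set xi | ctrl_dom K (cl_output P K w xi) (cl_input K xi)].

Definition cl_field (R : realType) (n s m r nw nc : nat)
    (P : plant R n m r nw) (pb : steady_problem R m r nw nc)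
    (K : controller R s m r nc) (w : 'cV[R]_nw) (xi : 'cV[R]_(n + s)) :
    'cV[R]_(n + s) :=
  let u := cl_input K xi in
  let z := cl_output P K w xi in
  col_mx (plA P *m usubmx xi + plB P *m u + plBw P *m w)
         (ctrl_field K (dsubmx xi) z u (con_error pb w z u)).

Definition solves_OSS (R : realType) (n s m r nw nc : nat)
    (P : plant R n m r nw) (pb : steady_problem R m r nw nc)
    (W : set 'cV[R]_nw) (K : controller R s m r nc) : Prop :=
  forall w : 'cV[R]_nw, W w ->
    exists xi : 'cV[R]_(n + s),
      [/\ equilibrium (cl_field P pb K w) (cl_dom P K w) xi,
          forall xi', equilibrium (cl_field P pb K w) (cl_dom P K w) xi' ->
            xi' = xi,
          locally_exp_stable (cl_field P pb K w) (cl_dom P K w) xi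
        & optimal P pb w (cl_output P K w xi) (cl_input K xi)].

(* tau eta1' = - Tu^T grad f0 (u) - Tz^T grad g0 (z),
   tau eta2' = - (Hz z + Hu u + Hw w),  u = K1 eta1 + K2 eta2. *)
Definition gradient_controller (R : realType) (m r nw nc q : nat)
    (pb : steady_problem R m r nw nc) (Tz : 'M[R]_(r, q)) (Tu : 'M[R]_(m, q))
    (K1 : 'M[R]_(m, q)) (K2 : 'M[R]_(m, nc)) (tau : R) :
    controller R (q + nc) m r nc :=
  {| ctrl_dom := fun z u => (domU pb)° u /\ (domZ pb)° z;
     ctrl_field := fun _ z u e =>
       tau^-1 *: col_mx (- (Tu^T *m grad (fine \o cost_f pb) u)
                         - Tz^T *m grad (fine \o cost_g pb) z)
                        (- e);
     ctrl_out := fun eta => K1 *m usubmx eta + K2 *m dsubmx eta |}.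

(* Main.v *)
Require Import Defs.
From HB Require Import structures.
From mathcomp Require Import all_boot all_order all_algebra.
From mathcomp Require Import complex ring lra.
From mathcomp Require Import all_classical all_reals all_analysis.

Set Implicit Arguments.
Unset Strict Implicit.
Unset Printing Implicit Defensive.

Import Order.TTheory GRing.Theory Num.Theory.
Import numFieldNormedType.Exports.

Local Open Scope classical_set_scope.
Local Open Scope ring_scope.

(** In the deviation [x + A^-1 (B u + Bw w)] of the plant from its quasi-steady
    state, the plant is [A] times the deviation, and the controller state obeys
    the reduced loop [tau eta' = B K eta + B1 Delta (E1 K eta) + ...], in which
    the plant is replaced by its DC gains.  Everything comes from one strict
    inequality for this reduced loop: with [Pm = Y^-1],

      2 <e, Pm (B K e + B1 d)> + [d; E1 K e]^T Theta [d; E1 K e] < 0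

    for [(e, d) <> 0].  The matrix inequality, restricted to a zero performance
    output, is its dual form ([lmi_dual], [dualization], [primal_of_dual]); the
    dualization works because the multipliers are nonsingular and negative on a
    subspace of half the dimension.  The sector form is nonnegative on increments
    of the gradients ([class_sector]); on an open convex domain this requires a
    local-to-global version of the Baillon-Haddad theorem ([cocoercive]).

    Uniqueness: for two equilibria the first term of the inequality vanishes and
    the second one is nonnegative, so that [e = 0] ([equilibrium_unique]).

    Existence: closing the loop with a scalar gain of the sector shows that
    [B + B1 G E1] and [K] compose to an invertible matrix; a dimension count then
    makes [K] square ([gain_surjective]), hence every input is [K eta] for some
    [eta], in particular the optimal one.  At an interior optimum the gradient is
    orthogonal to the range of [T] ([optimal_stationary]), which is the first
    controller equation; feasibility is the second ([loop_equilibrium]).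

    Stability: [S] from Lyapunov's theorem for [A] ([hurwitz_lyapunov]) and [Pm]
    add up to a Lyapunov form of the whole loop.  The controller moves at speed
    [1/tau]; in the derivative of the form, the terms coupling both states are
    [O(1/tau)], quadratic, and controlled by the strict inequality up to a multiple
    of the squared plant deviation ([slow_fast_bound]), which the plant absorbs for
    [tau] large ([loop_stable]).  The threshold only depends on the matrices, hence
    is uniform in [w].  Lyapunov's direct method ([lyapunov_exp_stable]) then gives
    the exponential bound, and the existence of solutions follows from the
    Cauchy-Lipschitz theorem ([global_solution]). *)

(** * Quadratic forms *)

Section Dot.
Variable R : realType.

Definition dot (d : nat) (u v : 'cV[R]_d) : R := (u^T *m v) 0 0.

Lemma dotE d (u v : 'cV[R]_d) : dot u v = \sum_i u i 0 * v i 0.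
Proof. by rewrite /dot mxE; apply: eq_bigr => i _; rewrite mxE. Qed.

Lemma dotC d (u v : 'cV[R]_d) : dot u v = dot v u.
Proof. by rewrite !dotE; apply: eq_bigr => i _; rewrite mulrC. Qed.

Lemma dotDl d (u v w : 'cV[R]_d) : dot (u + v) w = dot u w + dot v w.
Proof. by rewrite /dot linearD mulmxDl mxE. Qed.

Lemma dotDr d (u v w : 'cV[R]_d) : dot u (v + w) = dot u v + dot u w.
Proof. by rewrite dotC dotDl dotC [dot w u]dotC. Qed.

Lemma dotZl d c (u v : 'cV[R]_d) : dot (c *: u) v = c * dot u v.
Proof. by rewrite /dot linearZ /= -scalemxAl mxE. Qed.

Lemma dotZr d c (u v : 'cV[R]_d) : dot u (c *: v) = c * dot u v.
Proof. by rewrite dotC dotZl dotC. Qed.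

Lemma dotNl d (u v : 'cV[R]_d) : dot (- u) v = - dot u v.
Proof. by rewrite -scaleN1r dotZl mulN1r. Qed.

Lemma dotNr d (u v : 'cV[R]_d) : dot u (- v) = - dot u v.
Proof. by rewrite dotC dotNl dotC. Qed.

Lemma dot0l d (u : 'cV[R]_d) : dot 0 u = 0.
Proof. by rewrite -(scale0r u) dotZl mul0r. Qed.

Lemma dot0r d (u : 'cV[R]_d) : dot u 0 = 0.
Proof. by rewrite dotC dot0l. Qed.

Lemma dot_mulmxr d e (A : 'M[R]_(d, e)) u v : dot u (A *m v) = dot (A^T *m u) v.
Proof. by rewrite /dot trmx_mul trmxK mulmxA. Qed.

Lemma dot_col d e (a c : 'cV[R]_d) (b f : 'cV[R]_e) :
  dot (col_mx a b) (col_mx c f) = dot a c + dot b f.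
Proof. by rewrite /dot tr_col_mx mul_row_col mxE. Qed.

Lemma dot_ge0 d (u : 'cV[R]_d) : 0 <= dot u u.
Proof. by rewrite dotE sumr_ge0 // => i _; rewrite -expr2 sqr_ge0. Qed.

Lemma dot_eq0 d (u : 'cV[R]_d) : (dot u u == 0) = (u == 0).
Proof.
apply/idP/idP => [|/eqP ->]; last by rewrite dot0l.
rewrite dotE psumr_eq0 => [/allP u0|i _]; last by rewrite -expr2 sqr_ge0.
apply/eqP/matrixP => i j; rewrite ord1 mxE.
by have := u0 i (mem_index_enum _); rewrite -expr2 sqrf_eq0 => /eqP.
Qed.

Lemma dot_gt0 d (u : 'cV[R]_d) : (0 < dot u u) = (u != 0).
Proof. by rewrite lt_def dot_eq0 dot_ge0 andbT. Qed.

Lemma quadformE d (X : 'M[R]_d) v : quadform X v = dot v (X *m v).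
Proof. by rewrite /quadform /dot mulmxA. Qed.

Definition dot_expand := (dotDl, dotDr, dotNl, dotNr, dotZl, dotZr).

Lemma dot_young d (u v : 'cV[R]_d) (k : R) : 0 < k ->
  2 * dot u v <= k * dot u u + k^-1 * dot v v.
Proof.
move=> k0; have := dot_ge0 (k *: u - v).
rewrite !dot_expand (dotC v u) => H.
rewrite -(ler_pM2l k0) mulrDr [k * (k^-1 * _)]mulrA divff ?gt_eqF// mul1r.
lra.
Qed.

(** With [b = <u, Xv>], the value of the form at [q(v) u - b v] is
    [q(v) (q(u) q(v) - b^2)].  When [q(v)] vanishes the roles of [u] and [v] are
    exchanged, and when both vanish the values at [u + v] and [u - v] give
    [b = 0]. *)
Lemma psd_cauchy d (X : 'M[R]_d) (u v : 'cV[R]_d) : possemidef X ->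
  dot u (X *m v) ^+ 2 <= quadform X u * quadform X v.
Proof.
move=> [Xs Xp]; rewrite !quadformE.
have sym a b : dot a (X *m b) = dot b (X *m a) by rewrite dot_mulmxr Xs dotC.
have q a b s t : 0 <= s ^+ 2 * dot a (X *m a) + 2 * s * t * dot a (X *m b)
                     + t ^+ 2 * dot b (X *m b).
  have := Xp (s *: a + t *: b).
  rewrite quadformE mulmxDr -!scalemxAr !dot_expand (sym b a); lra.
have qu := Xp u; have qv := Xp v; rewrite !quadformE in qu qv.
set b := dot u (X *m v).
have [v0|v0] := ltP 0 (dot v (X *m v)).
  have := q u v (dot v (X *m v)) (- b); rewrite -/b => H.
  rewrite -subr_ge0 -(pmulr_rge0 _ v0); lra.
have {qv v0}v0 : dot v (X *m v) = 0 by apply/le_anti; rewrite v0 qv.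
have [u0|u0] := ltP 0 (dot u (X *m u)).
  have := q u v (- b) (dot u (X *m u)); rewrite -/b v0 => H.
  rewrite -subr_ge0 -(pmulr_rge0 _ u0); lra.
have {qu u0}u0 : dot u (X *m u) = 0 by apply/le_anti; rewrite u0 qu.
have := q u v 1 1; have := q u v 1 (-1); rewrite -/b u0 v0 => H1 H2.
have -> : b = 0 by lra.
by rewrite expr0n mulr0.
Qed.

Lemma quadform1 d (v : 'cV[R]_d) : quadform 1%:M v = dot v v.
Proof. by rewrite quadformE mul1mx. Qed.

Lemma dot_cauchy d (u v : 'cV[R]_d) : dot u v ^+ 2 <= dot u u * dot v v.
Proof.
have := @psd_cauchy d 1%:M u v; rewrite mul1mx !quadform1; apply.
by split=> [|w]; rewrite ?tr_scalar_mx // quadform1 dot_ge0.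
Qed.

Lemma mulmx_bound d e (A : 'M[R]_(d, e)) :
  exists2 c, 0 < c & forall v, dot (A *m v) (A *m v) <= c * dot v v.
Proof.
exists (1 + \sum_i dot (row i A)^T (row i A)^T) => [|v].
  by rewrite ltr_pwDl // sumr_ge0 // => i _; apply: dot_ge0.
rewrite mulrDl mul1r ler_wpDl ?dot_ge0// mulr_suml dotE ler_sum // => i _.
have -> : (A *m v) i 0 = dot (row i A)^T v.
  by rewrite dotE mxE; apply: eq_bigr => j _; rewrite !mxE.
by rewrite -expr2 dot_cauchy.
Qed.

Lemma injmx_unit d (A : 'M[R]_d) : (forall v : 'cV_d, A *m v = 0 -> v = 0) ->
  A \in unitmx.
Proof.
move=> inj; rewrite -unitmx_tr -row_free_unit -kermx_eq0.
apply/eqP/row_matrixP => i; rewrite row0.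
have /inj : A *m (row i (kermx A^T))^T = 0.
  by apply: trmx_inj; rewrite trmx_mul trmxK trmx0 -row_mul mulmx_ker row0.
by move/(congr1 trmx); rewrite trmxK trmx0.
Qed.

(** The spectral bound is obtained without eigenvalues: for the symmetrized matrix
    [Y], the Cauchy-Schwarz inequality of the form [q] itself gives
    [|Yv|^4 = <v, Y(Yv)>^2 <= q(v) q(Yv)], and [q(Yv) <= C |Yv|^2], while
    [v = Y^-1 (Y v)]. *)
Lemma posdef_lower d (X : 'M[R]_d) :
  (forall v : 'cV_d, v != 0 -> 0 < quadform X v) ->
  exists2 c, 0 < c & forall v, c * dot v v <= quadform X v.
Proof.
move=> Xp.
pose Y := X + X^T.
have YE v : quadform Y v = 2 * quadform X v.
  rewrite !quadformE mulmxDl dotDr [dot v (X^T *m v)]dot_mulmxr trmxK.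
  by rewrite [dot (X *m v) v]dotC -mulr2n mulr_natl.
have Ys : Y^T = Y by rewrite /Y linearD /= trmxK addrC.
have Yp v : v != 0 -> 0 < quadform Y v by move=> /Xp; rewrite YE => ?; lra.
have Yge v : 0 <= quadform Y v.
  have [->|/Yp/ltW//] := eqVneq v 0; by rewrite quadformE dot0l.
have Yu : Y \in unitmx.
  apply: injmx_unit => v Yv; apply/eqP; apply: contraT => /Yp.
  by rewrite quadformE Yv dot0r ltxx.
have [c1 c10 H1] := mulmx_bound (invmx Y).
have [c2 c20 H2] := mulmx_bound Y.
exists (c1 * (1 + c2))^-1 => [|v]; first by rewrite invr_gt0 mulr_gt0 // addr_gt0.
rewrite mulrC ler_pdivrMr ?mulr_gt0 ?addr_gt0//.
set s := dot (Y *m v) (Y *m v).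
have vs : dot v v <= c1 * s by have := H1 (Y *m v); rewrite mulKmx.
have s0 : 0 <= s by exact: dot_ge0.
have qw : quadform Y (Y *m v) <= (1 + c2) / 2 * s.
  have := dot_young (Y *m v) (Y *m (Y *m v)) ltr01.
  have := H2 (Y *m v); rewrite quadformE invr1 -/s => ? ?; lra.
have cs : s ^+ 2 <= quadform Y v * quadform Y (Y *m v).
  have := @psd_cauchy d Y v (Y *m v) (conj Ys Yge).
  by rewrite [dot v (Y *m (Y *m v))]dot_mulmxr Ys.
have sq : s <= (1 + c2) / 2 * quadform Y v.
  have [s1|s1] := ltP 0 s; last first.
    apply: (le_trans s1); rewrite mulr_ge0//; lra.
  rewrite -(ler_pM2l s1) -expr2 (le_trans cs)//.
  by rewrite mulrA [s * _]mulrC [leRHS]mulrC ler_wpM2l.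
apply: (le_trans vs); move: sq; rewrite YE => sq.
have : c1 * s <= c1 * ((1 + c2) / 2 * (2 * quadform X v)) by rewrite ler_pM2l.
by move/le_trans; apply; rewrite le_eqVlt; apply/orP; left; apply/eqP; field.
Qed.

Lemma quadform_upper d (X : 'M[R]_d) :
  exists2 c, 0 < c & forall v, quadform X v <= c * dot v v.
Proof.
have [c c0 H] := mulmx_bound X.
exists (1 + c) => [|v]; first exact: addr_gt0.
have := dot_young v (X *m v) ltr01; have := H v; have := dot_ge0 v.
have := mulr_ge0 (ltW c0) (dot_ge0 v).
rewrite invr1 quadformE => ? ? ? ?; lra.
Qed.

(** A form which is negative in the second variable stays so after adding
    the first one, at the price of a multiple of its square. *)
Lemma quadform_perturb n k (X : 'M[R]_(n + k)) :
  (forall y : 'cV_k, y != 0 -> quadform X (col_mx 0 y) < 0) ->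
  exists kappa eps, [/\ 0 < kappa, 0 < eps &
    forall x y, quadform X (col_mx x y) <= kappa * dot x x - eps * dot y y].
Proof.
move=> Xn.
have XE x y : quadform X (col_mx x y) = dot x (ulsubmx X *m x)
    + dot x ((ursubmx X + (dlsubmx X)^T) *m y) + dot y (drsubmx X *m y).
  rewrite quadformE -{1}[X]submxK mul_block_col dot_col mulmxDl !dotDr.
  by rewrite [dot y (dlsubmx X *m x)]dot_mulmxr [dot _ x]dotC !addrA.
have [|e e0 He] := @posdef_lower k (- drsubmx X).
  move=> y /Xn; rewrite XE !dot0l !add0r quadformE mulNmx dotNr oppr_gt0//.
have [a a0 Ha] := mulmx_bound (ulsubmx X).
have [c c0 Hc] := mulmx_bound (ursubmx X + (dlsubmx X)^T).
exists ((1 + a) / 2 + c / e / 2), (e / 2); split; last 1 first.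
- move=> x y; rewrite XE.
  have h1 := dot_young x (ulsubmx X *m x) ltr01.
  have ec : 0 < c / e by rewrite divr_gt0.
  have h2 := dot_young x ((ursubmx X + (dlsubmx X)^T) *m y) ec.
  have h3 := He y; rewrite quadformE mulNmx dotNr in h3.
  have h4 := Ha x; have h5 := Hc y.
  rewrite invr1 in h1.
  set z := _ *m y in h2 h5 *.
  have h6 : (c / e)^-1 * dot z z <= e * dot y y.
    by rewrite invf_div mulrAC -mulrA ler_pM2l// ler_pdivrMr// mulrC.
  move: (_ ^-1 * dot z z) h2 h6 => t h2 h6.
  move: (c / e) h2 => g h2.
  lra.
- by rewrite addr_gt0// ?divr_gt0 ?addr_gt0.
- by rewrite divr_gt0.
Qed.

Lemma normr_dot d (v : 'cV[R]_d) : `|v| ^+ 2 <= dot v v.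
Proof.
have [->|v0] := eqVneq v 0; first by rewrite normr0 expr0n dot0l.
have [|[i j] /= vE] := @mx_norm_neq0 _ _ _ v.
  by apply: contra v0 => /eqP/mx_norm_eq0 ->.
have -> : `|v| = `|v i j| := vE.
rewrite ord1 real_normK ?num_real// dotE (bigD1 i)//= expr2 lerDl sumr_ge0// => k _.
by rewrite -expr2 sqr_ge0.
Qed.

Lemma normr_coord d (v : 'cV[R]_d) i : `|v i 0| <= `|v|.
Proof.
rewrite [leRHS]/Num.norm /= mx_normrE.
exact: (le_bigmax _ (fun ij : 'I_d * 'I_1 => `|v ij.1 ij.2|) (i, 0)).
Qed.

Lemma dot_normr d (v : 'cV[R]_d) : dot v v <= d%:R * `|v| ^+ 2.
Proof.
rewrite dotE -[d in d%:R]card_ord -sum1_card natr_sum mulr_suml ler_sum// => i _.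
rewrite mul1r -expr2 -[leLHS]real_normK ?num_real// ler_sqr ?nnegrE//.
exact: normr_coord.
Qed.
End Dot.

(** * Lyapunov's theorem for Hurwitz matrices *)

Section Hurwitz.
Variable R : realType.

Lemma trig_ursubmx n (T : 'M[R]_(1 + n)) : is_trig_mx T -> ursubmx T = 0.
Proof.
move=> /is_trig_mxP tr; apply/matrixP => i j; rewrite !mxE tr//=.
by rewrite ord1.
Qed.

(** For a triangular complex matrix [T1 + i T2] the weight is built from the
    last coordinate up: a large enough weight on the first coordinate absorbs
    the coupling of the others with it. *)
Lemma trig_lyapunov n (T1 T2 : 'M[R]_n) :
  is_trig_mx T1 -> is_trig_mx T2 -> (forall i, T1 i i < 0) ->
  exists D : 'M[R]_n, posdef D /\ exists2 eps, 0 < eps &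
    forall a b, dot a (D *m (T1 *m a - T2 *m b)) +
                dot b (D *m (T2 *m a + T1 *m b)) <=
                - eps * (dot a a + dot b b).
Proof.
elim: n T1 T2 => [|n IH] T1 T2 tr1 tr2 neg.
  exists 1%:M; split; last first.
    by exists 1 => // a b; rewrite !dotE !big_ord0; lra.
  by split=> [|v]; rewrite ?tr_scalar_mx// [v]flatmx0 eqxx.
rewrite -(add1n n) in T1 T2 tr1 tr2 neg *.
have u1 := trig_ursubmx tr1; have u2 := trig_ursubmx tr2.
have tr_dr (T : matrix R (1 + n) (1 + n)) : is_trig_mx T -> is_trig_mx (drsubmx T).
  by move=> /is_trig_mxP tr; apply/is_trig_mxP => i j ij; rewrite !mxE tr//= ltn_add2l.
have [D [[Ds Dp] [e e0 He]]] := IH _ _ (tr_dr _ tr1) (tr_dr _ tr2)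
  (fun i => ltac:(by rewrite !mxE; exact: neg)).
set t := T1 (lshift n 0) (lshift n 0); have t0 : t < 0 by exact: neg.
have [k1 k10 H1] := mulmx_bound (D *m dlsubmx T1).
have [k2 k20 H2] := mulmx_bound (D *m dlsubmx T2).
(* Young's inequality bounds the coupling terms by [e / 2] times the square of the
   other coordinates plus [(k1 + k2) / e] times the square of the first one. *)
pose d := (e / 2 + e^-1 * (k1 + k2)) / - t.
have d0 : 0 < d.
  rewrite divr_gt0 ?oppr_gt0// addr_gt0 ?divr_gt0// mulr_gt0 ?invr_gt0//.
  exact: addr_gt0.
have dt : d * t = - (e / 2 + e^-1 * (k1 + k2)).
  by rewrite /d; field; rewrite gt_eqF ?e0//= lt_eqF.
exists (bdiag (d%:M : 'M[R]_1) D); split.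
  split; first by rewrite /bdiag tr_block_mx !trmx0 tr_scalar_mx Ds.
  move=> v; rewrite -[v]vsubmxK quadformE /bdiag mul_block_col !mul0mx addr0 add0r.
  rewrite dot_col mul_scalar_mx dotZr -quadformE col_mx_eq0 negb_and.
  have Dge w : 0 <= quadform D w.
    by have [->|/Dp/ltW//] := eqVneq w 0; rewrite quadformE dot0l.
  case/orP => [v0|/Dp v0]; last by rewrite ltr_wpDl// mulr_ge0 ?dot_ge0// ltW.
  by rewrite ltr_pwDl ?Dge// mulr_gt0// dot_gt0.
exists (e / 2) => [|a b]; first by rewrite divr_gt0.
rewrite -[a]vsubmxK -[b]vsubmxK.
move: (usubmx a) (dsubmx a) (usubmx b) (dsubmx b) => al a' be b'.
have E (T : 'M[R]_(1 + n)) x y : ursubmx T = 0 -> T *m col_mx x y =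
    col_mx (T (lshift n 0) (lshift n 0) *: x) (dlsubmx T *m x + drsubmx T *m y).
  move=> u; rewrite -{1}[T]submxK mul_block_col u mul0mx addr0.
  congr col_mx; rewrite [ulsubmx T]mx11_scalar mul_scalar_mx !mxE.
  by congr (T _ _ *: _); apply/val_inj.
rewrite !E// opp_col_mx !add_col_mx /bdiag !mul_block_col !mul0mx !addr0 !add0r.
rewrite !dot_col !mul_scalar_mx -/t; set s := T2 _ _.
have -> : dlsubmx T1 *m al + drsubmx T1 *m a' - (dlsubmx T2 *m be + drsubmx T2 *m b')
   = (dlsubmx T1 *m al - dlsubmx T2 *m be) + (drsubmx T1 *m a' - drsubmx T2 *m b').
  by rewrite opprD addrACA.
rewrite [dlsubmx T2 *m al + _ + _]addrACA !(mulmxDr D) !dotDr.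
have h := He a' b'.
set z1 := D *m dlsubmx T1 *m al - D *m dlsubmx T2 *m be.
set z2 := D *m dlsubmx T2 *m al + D *m dlsubmx T1 *m be.
have y1 := dot_young a' z1 e0; have y2 := dot_young b' z2 e0.
have w1 : dot z1 z1 <= 2 * (k1 * dot al al) + 2 * (k2 * dot be be).
  have := dot_ge0 (D *m dlsubmx T1 *m al + D *m dlsubmx T2 *m be).
  have := H1 al; have := H2 be.
  rewrite /z1 !dot_expand (dotC (D *m dlsubmx T2 *m be) (D *m dlsubmx T1 *m al)); lra.
have w2 : dot z2 z2 <= 2 * (k2 * dot al al) + 2 * (k1 * dot be be).
  have := dot_ge0 (D *m dlsubmx T2 *m al - D *m dlsubmx T1 *m be).
  have := H2 al; have := H1 be.
  rewrite /z2 !dot_expand (dotC (D *m dlsubmx T1 *m be) (D *m dlsubmx T2 *m al)); lra.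
have w3 : e^-1 * (dot z1 z1 + dot z2 z2) <=
          e^-1 * (2 * (k1 + k2) * (dot al al + dot be be)).
  rewrite ler_pM2l ?invr_gt0//; lra.
have q1 : dot a' z1 = dot a' (D *m dlsubmx T1 *m al) - dot a' (D *m dlsubmx T2 *m be).
  by rewrite /z1 dotDr dotNr.
have q2 : dot b' z2 = dot b' (D *m dlsubmx T2 *m al) + dot b' (D *m dlsubmx T1 *m be).
  by rewrite /z2 dotDr.
rewrite !mulmxN !mulmxA !dot_expand (dotC be al).
rewrite !mulmxDr !mulmxN !mulmxA !dot_expand in h.
have dtal := congr1 (fun x => x * dot al al) dt.
have dtbe := congr1 (fun x => x * dot be be) dt.
move: dtal dtbe w3 y1 y2 h => /=; rewrite !mulrDr !mulrDl !mulrA.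
lra.
Qed.

(** Lyapunov's theorem.  The Schur decomposition [P A = T P] reduces it to a
    triangular complex matrix; the real and imaginary parts [X], [Y] of [P]
    pull the weight back to a real form. *)
Lemma hurwitz_lyapunov n (A : 'M[R]_n) : hurwitz A ->
  exists S : 'M[R]_n, posdef S /\
    forall x, 2 * dot x (S *m (A *m x)) <= - dot x x.
Proof.
case: n A => [|n] A hA.
  exists 1%:M; split; last by move=> x; rewrite !dotE !big_ord0; lra.
  by split=> [|v]; rewrite ?tr_scalar_mx// [v]flatmx0 eqxx.
have [P /unitarymx_unit Pu] := @Schur (complex R) n.+1 (map_mx (real_complex R) A) isT.
pose T := P *m map_mx (real_complex R) A *m invmx P.
rewrite /similar_to conjumx// -/T => trT.
have PA : P *m map_mx (real_complex R) A = T *m P by rewrite /T mulmxKV.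
clearbody T.
have diagT i : complex.Re (T i i) < 0.
  apply: hA; have /eigenvalueP[v vT v0] : eigenvalue T (T i i).
    rewrite eigenvalue_root_char char_poly_trig// rootE horner_prod (bigD1 i)//=.
    by rewrite hornerXsubC subrr mul0r.
  apply/eigenvalueP; exists (v *m P); first by rewrite -mulmxA PA mulmxA vT scalemxAl.
  by apply: contra v0 => /eqP vP; rewrite -[v](mulmxK Pu) vP mul0mx.
have trc (f : complex R -> R) : f 0 = 0 -> is_trig_mx (map_mx f T).
  by move=> f0; apply/is_trig_mxP => i j ij; rewrite !mxE (is_trig_mxP trT).
have [|D [Dp [e e0 He]]] := @trig_lyapunov n.+1 (map_mx (@complex.Re R) T)
  (map_mx (@complex.Im R) T) (trc _ erefl) (trc _ erefl).
  by move=> i; rewrite mxE.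
pose X := map_mx (@complex.Re R) P; pose Y := map_mx (@complex.Im R) P.
have PAij i j : (P *m map_mx (real_complex R) A) i j =
    \sum_k P i k * real_complex R (A k j).
  by rewrite mxE; apply: eq_bigr => k _; rewrite mxE.
have XA : X *m A = map_mx (@complex.Re R) T *m X - map_mx (@complex.Im R) T *m Y.
  apply/matrixP => i j; have /matrixP/(_ i j)/(congr1 (@complex.Re R)) := PA.
  rewrite PAij !mxE !(raddf_sum (@complex.Re R)) -sumrB => E.
  transitivity (\sum_k complex.Re (P i k * real_complex R (A k j))).
    by apply: eq_bigr => k _; rewrite !mxE; case: (P i k) => ? ? /=; rewrite mulr0 subr0.
  rewrite E; apply: eq_bigr => k _; rewrite !mxE.
  by case: (T i k) => ? ?; case: (P k j).
have YA : Y *m A = map_mx (@complex.Im R) T *m X + map_mx (@complex.Re R) T *m Y.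
  apply/matrixP => i j; have /matrixP/(_ i j)/(congr1 (@complex.Im R)) := PA.
  rewrite PAij !mxE !(raddf_sum (@complex.Im R)) -big_split => E.
  transitivity (\sum_k complex.Im (P i k * real_complex R (A k j))).
    by apply: eq_bigr => k _; rewrite !mxE; case: (P i k) => ? ? /=; rewrite mulr0 add0r.
  rewrite E; apply: eq_bigr => k _; rewrite !mxE /=.
  by case: (T i k) => ? ?; case: (P k j) => ? ? /=; rewrite addrC.
have inj x : X *m x = 0 -> Y *m x = 0 -> x = 0.
  move=> Xx Yx; have : P *m map_mx (real_complex R) x = 0.
    apply/matrixP => i j; rewrite !mxE; apply/eqP; rewrite eq_complex.
    apply/andP; split; apply/eqP.
      move/matrixP: Xx => /(_ i j); rewrite !mxE => X0.
      rewrite -[RHS]X0 (raddf_sum (@complex.Re R)).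
      by apply: eq_bigr => k _; rewrite !mxE; case: (P i k) => ? ? /=; rewrite mulr0 subr0.
    move/matrixP: Yx => /(_ i j); rewrite !mxE => Y0.
    rewrite -[RHS]Y0 (raddf_sum (@complex.Im R)).
    by apply: eq_bigr => k _; rewrite !mxE; case: (P i k) => ? ? /=; rewrite mulr0 add0r.
  move/(congr1 (mulmx (invmx P))); rewrite mulKmx// mulmx0 => /matrixP x0.
  apply/matrixP => i j; have := x0 i j; rewrite !mxE => /(congr1 (@complex.Re R)).
  by [].
have SE Z v w : dot v ((X^T *m Z *m X + Y^T *m Z *m Y) *m w) =
    dot (X *m v) (Z *m (X *m w)) + dot (Y *m v) (Z *m (Y *m w)).
  by rewrite mulmxDl dotDr -!mulmxA ![dot v _]dot_mulmxr !trmxK.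
have Dge w : 0 <= quadform D w.
  by have [->|/(proj2 Dp)/ltW//] := eqVneq w 0; rewrite quadformE dot0l.
have pos Z v : posdef Z -> v != 0 ->
    0 < quadform (X^T *m Z *m X + Y^T *m Z *m Y) v.
  move=> [_ Zp] v0; rewrite quadformE SE -!quadformE.
  have Zge w : 0 <= quadform Z w.
    by have [->|/Zp/ltW//] := eqVneq w 0; rewrite quadformE dot0l.
  have [Xv|Xv] := eqVneq (X *m v) 0; last by rewrite ltr_pwDl ?Zge ?Zp.
  rewrite ltr_wpDl// Zp//; apply: contra v0 => /eqP Yv; apply/eqP; exact: inj.
have id1 : posdef (1%:M : 'M[R]_n.+1).
  by split=> [|v]; rewrite ?tr_scalar_mx// quadform1 dot_gt0.
have [c c0 Hc] := posdef_lower (fun v => @pos 1%:M v id1).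
have ce0 : 0 < 2 * (e * c) by rewrite !mulr_gt0.
exists ((2 * (e * c))^-1 *: (X^T *m D *m X + Y^T *m D *m Y)); split.
  split=> [|v v0].
    by rewrite linearZ linearD /= !trmx_mul !trmxK (proj1 Dp) !mulmxA.
  by rewrite quadformE -scalemxAl dotZr mulr_gt0 ?invr_gt0// -quadformE pos.
move=> x; rewrite -scalemxAl dotZr SE !(mulmxA X) !(mulmxA Y) XA YA.
have := He (X *m x) (Y *m x); have := Hc x.
rewrite quadformE SE !mul1mx !mulmxDl !mulNmx -!mulmxA.
set s := dot (X *m x) (X *m x) + _; set s' := dot (X *m x) _ + _ => h1 h2.
rewrite mulrCA -ler_pdivlMl ?invr_gt0// invrK mulrN.
have : e * (c * dot x x) <= e * s by rewrite ler_pM2l.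
lra.
Qed.
End Hurwitz.

(** * Dualization and multipliers *)

Section Dualization.
Variable R : realType.

(** The dualization lemma: a nonsingular form [X] which is positive, through
    its inverse, on the annihilator [J] of the range of [S], is negative on
    the range of [S], as soon as it is negative on some complementary space,
    here the kernel of [Sg].  For [s] in the range of [S] there is
    a [w = X^-1 J c] with [s - w] in that kernel, because [Sg X^-1 J] is
    injective and square; and [w] is [X]-orthogonal to [s], so that
    [X(s) + X(w) = X(s - w) <= 0 < X(w)], unless [c = 0], in which case [s]
    itself belongs to the kernel. *)
Lemma dualization d k l (X X' : 'M[R]_d) (J : 'M[R]_(d, k)) (S : 'M[R]_(d, l))
    (Sg : 'M[R]_(k, d)) :
  X^T = X -> X *m X' = 1%:M -> J^T *m S = 0 ->
  (forall v, Sg *m v = 0 -> v != 0 -> quadform X v < 0) ->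
  (forall c : 'cV[R]_k, c != 0 -> 0 < quadform X' (J *m c)) ->
  forall y, S *m y != 0 -> quadform X (S *m y) < 0.
Proof.
move=> Xs XX' JS neg pos y Sy.
have qw c : quadform X (X' *m (J *m c)) = quadform X' (J *m c).
  by rewrite !quadformE (mulmxA X) XX' mul1mx dotC.
have Gu : Sg *m X' *m J \in unitmx.
  apply: injmx_unit => c Gc; apply/eqP; apply: contraT => c0.
  have w0 : X' *m (J *m c) != 0.
    apply/eqP => w0; have := pos c c0.
    by rewrite -qw w0 quadformE dot0l ltxx.
  have := neg (X' *m (J *m c)); rewrite !mulmxA Gc -!mulmxA => /(_ erefl w0).
  by rewrite qw => /(lt_trans (pos c c0)); rewrite ltxx.
pose c := invmx (Sg *m X' *m J) *m (Sg *m (S *m y)).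
pose w := X' *m (J *m c).
have Sw : Sg *m (S *m y - w) = 0.
  rewrite mulmxBr; have -> : Sg *m w = Sg *m X' *m J *m c by rewrite /w !mulmxA.
  by rewrite /c mulKVmx// subrr.
have [c0|c0] := eqVneq c 0.
  by move: Sw; rewrite /w c0 !mulmx0 subr0 => /neg; exact.
have Xw : X *m w = J *m c by rewrite /w mulmxA XX' mul1mx.
have ortho : dot (S *m y) (X *m w) = 0.
  by rewrite Xw dot_mulmxr mulmxA JS mul0mx dot0l.
have : quadform X (S *m y - w) <= 0.
  have [->|/(neg _ Sw)/ltW//] := eqVneq (S *m y - w) 0.
  by rewrite quadformE dot0l.
have := pos c c0; rewrite -qw -/w !quadformE mulmxBr !dot_expand ortho.
rewrite [dot w (X *m (S *m y))]dot_mulmxr Xs [dot (X *m w) _]dotC ortho.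
lra.
Qed.

Lemma posdef_unit d (Y : 'M[R]_d) : posdef Y -> Y \in unitmx.
Proof.
move=> [_ Yp]; apply: injmx_unit => v Yv; apply/eqP; apply: contraT => /Yp.
by rewrite quadformE Yv dot0r ltxx.
Qed.

Lemma posdef_inv d (Y : 'M[R]_d) : posdef Y -> posdef (invmx Y).
Proof.
move=> Ypd; have Yu := posdef_unit Ypd; have [Ys Yp] := Ypd.
split=> [|v v0]; first by rewrite trmx_inv Ys.
have /Yp : invmx Y *m v != 0.
  by apply: contra v0 => /eqP w0; rewrite -[v](mulKVmx Yu) w0 mulmx0.
by rewrite !quadformE mulKVmx// dotC.
Qed.

Lemma primal_of_dual N p (Y AK : 'M[R]_N) (B1 : 'M[R]_(N, p)) (CK : 'M[R]_(p, N))
    (Th : 'M[R]_(p + p)) :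
  posdef Y -> Th^T = Th -> Th \in unitmx ->
  (forall x, x != 0 -> quadform Th (col_mx x (- x)) < 0) ->
  (forall a b, (a != 0) || (b != 0) ->
    0 < - 2 * dot (Y *m (AK^T *m a + CK^T *m b)) a
        + quadform (invmx Th) (col_mx (- (B1^T *m a)) b)) ->
  forall e del, (e != 0) || (del != 0) ->
    2 * dot e (invmx Y *m (AK *m e + B1 *m del))
      + quadform Th (col_mx del (CK *m e)) < 0.
Proof.
move=> Ypd Ts Tu Tn dual e del ed.
have Yu := posdef_unit Ypd; have [Ys _] := Ypd; have [Ps Pp] := posdef_inv Ypd.
pose X := bdiag (block_mx 0 (invmx Y) (invmx Y) 0) Th.
pose X' := bdiag (block_mx 0 Y Y 0) (invmx Th).
pose J : 'M[R]_(_, N + p) := col_mx (col_mx (row_mx (- AK^T) (- CK^T)) (row_mx 1%:M 0))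
  (col_mx (row_mx (- B1^T) 0) (row_mx 0 1%:M)).
pose S : 'M[R]_(_, N + p) := col_mx (col_mx (row_mx 1%:M 0) (row_mx AK B1))
  (col_mx (row_mx 0 1%:M) (row_mx CK 0)).
pose Sg : 'M[R]_(N + p, _) := block_mx (row_mx 1%:M 1%:M) 0 0 (row_mx 1%:M 1%:M).
have XE a b c f : quadform X (col_mx (col_mx a b) (col_mx c f)) =
    2 * dot a (invmx Y *m b) + quadform Th (col_mx c f).
  rewrite quadformE /X /bdiag !mul_block_col !mul0mx !(addr0, add0r) !dot_col.
  rewrite -quadformE [dot b _]dot_mulmxr Ps [dot _ a]dotC; lra.
have X'E a b c f : quadform X' (col_mx (col_mx a b) (col_mx c f)) =
    2 * dot a (Y *m b) + quadform (invmx Th) (col_mx c f).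
  rewrite quadformE /X' /bdiag !mul_block_col !mul0mx !(addr0, add0r) !dot_col.
  rewrite -quadformE [dot b _]dot_mulmxr Ys [dot _ a]dotC; lra.
have SE : S *m col_mx e del = col_mx (col_mx e (AK *m e + B1 *m del))
                                     (col_mx del (CK *m e)).
  by rewrite /S !mul_col_mx !mul_row_col !(mul1mx, mul0mx, addr0, add0r).
rewrite -XE -SE.
have SgE a b c f : Sg *m (col_mx (col_mx a b) (col_mx c f)) = col_mx (a + b) (c + f).
  by rewrite /Sg mul_block_col !mul_row_col !(mul1mx, mul0mx, addr0, add0r).
have opp_of (q : nat) (a b : 'cV[R]_q) : a + b = 0 -> b = - a.
  by move/eqP; rewrite addrC addr_eq0 => /eqP.
apply: (@dualization _ _ _ X X' J S Sg).
- by rewrite /X /bdiag !tr_block_mx !trmx0 Ps Ts.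
- rewrite /X /X' /bdiag !mulmx_block !(mul0mx, mulmx0, addr0, add0r).
  by rewrite mulVmx// mulmxV// -!scalar_mx_block.
- rewrite /J /S !tr_col_mx !tr_row_mx !linearN /= !trmxK !trmx1 !trmx0.
  rewrite !mul_row_col !mul_col_row !(mul0mx, mulmx0, mul1mx, mulmx1) !add_block_mx.
  by rewrite !(addr0, add0r, addNr) subrr; apply: block_mx0.
- move=> v; rewrite -[v]vsubmxK -[usubmx v]vsubmxK -[dsubmx v]vsubmxK SgE.
  move: (usubmx (usubmx v)) (dsubmx (usubmx v)) (usubmx (dsubmx v)) (dsubmx (dsubmx v)).
  move=> a b c f; rewrite -[X in _ = X]col_mx0 => /eq_col_mx[/opp_of-> /opp_of->].
  rewrite !col_mx_eq0 !oppr_eq0 !andbb negb_and XE mulmxN dotNr -quadformE.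
  have Pge w : 0 <= quadform (invmx Y) w.
    by have [->|/Pp/ltW//] := eqVneq w 0; rewrite quadformE dot0l.
  have Tge w : quadform Th (col_mx w (- w)) <= 0.
    by have [->|/Tn/ltW//] := eqVneq w 0; rewrite oppr0 col_mx0 quadformE dot0l.
  by case/orP => [/Pp|/Tn]; have := Tge c; have := Pge a; lra.
- move=> c; rewrite -[c]vsubmxK; move: (usubmx c) (dsubmx c) => a b.
  rewrite col_mx_eq0 negb_and => /dual.
  have -> : J *m col_mx a b = col_mx (col_mx (- (AK^T *m a + CK^T *m b)) a)
                                     (col_mx (- (B1^T *m a)) b).
    rewrite /J !mul_col_mx !mul_row_col !(mul1mx, mul0mx, addr0, add0r).
    by rewrite !mulNmx opprD.
  rewrite X'E dotNl [dot _ (Y *m a)]dot_mulmxr Ys; lra.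
- by rewrite SE !col_mx_eq0 !negb_and; case/orP: ed => ->; rewrite ?orbT.
Qed.

Lemma kron2I_quadform d (a b c e : R) (x y : 'cV[R]_d) :
  quadform (kron2I d a b c e) (col_mx x y) =
  a * dot x x + (b + c) * dot x y + e * dot y y.
Proof.
rewrite quadformE /kron2I mul_block_col dot_col !mul_scalar_mx !dot_expand (dotC y x).
by ring.
Qed.

Lemma kron2I_unit d (a b c e : R) : a * e - b * c != 0 ->
  kron2I d a b c e \in unitmx.
Proof.
move=> det; apply: injmx_unit => v; rewrite -[v]vsubmxK.
move: (usubmx v) (dsubmx v) => x y.
rewrite /kron2I mul_block_col !mul_scalar_mx -[X in _ = X]col_mx0.
move=> /eq_col_mx[h1 h2].
have x0 : (a * e - b * c) *: x = 0.
  have -> : (a * e - b * c) *: x = e *: (a *: x + b *: y) - b *: (c *: x + e *: y).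
    rewrite !scalerDr !scalerA scalerBl [e * a]mulrC [e * b]mulrC.
    by rewrite opprD addrACA subrr addr0.
  by rewrite h1 h2 !scaler0 subrr.
have y0 : (a * e - b * c) *: y = 0.
  have -> : (a * e - b * c) *: y = a *: (c *: x + e *: y) - c *: (a *: x + b *: y).
    rewrite !scalerDr !scalerA scalerBl [c * a]mulrC [c * b]mulrC.
    by rewrite opprD addrACA subrr add0r.
  by rewrite h1 h2 !scaler0 subrr.
move/eqP: x0; move/eqP: y0; rewrite !scaler_eq0 (negPf det) /= => /eqP-> /eqP->.
by rewrite col_mx0.
Qed.

(** What the argument uses of a multiplier, apart from the sector constraint:
    it is nonsingular and negative on a subspace of half the dimension, which
    makes the dualization possible, and the graph of some scalar gain belongs to
    the sector, which gives a linear loop to which the strict inequality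
    applies. *)
Record balanced_multiplier d (Th : 'M[R]_(d + d)) : Prop := BalancedMultiplier {
  mult_sym : Th^T = Th;
  mult_unit : Th \in unitmx;
  mult_neg : forall x, x != 0 -> quadform Th (col_mx x (- x)) < 0;
  mult_gain : exists g : R, forall x, 0 <= quadform Th (col_mx (g *: x) x) }.

Lemma class_balanced d (D : set 'cV[R]_d) phi Th :
  class_multiplier D phi Th -> balanced_multiplier Th.
Proof.
have aux a b e : a * e - b * b != 0 -> a - 2 * b + e < 0 ->
    (exists g : R, 0 <= a * g ^+ 2 + 2 * b * g + e) ->
    balanced_multiplier (kron2I d a b b e).
  move=> det neg [g Hg]; split.
  - by rewrite /kron2I tr_block_mx !tr_scalar_mx.
  - exact: kron2I_unit.
  - move=> x x0; rewrite kron2I_quadform !dot_expand.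
    have : (a - 2 * b + e) * dot x x < 0 by rewrite pmulr_llt0 ?dot_gt0.
    lra.
  - exists g => x; rewrite kron2I_quadform !dot_expand.
    have : 0 <= (a * g ^+ 2 + 2 * b * g + e) * dot x x by rewrite mulr_ge0 ?dot_ge0.
    lra.
(* The gain is [mu] for the strongly convex classes and 0 for the others. *)
case=> [_|L L0 _ _|mu mu0 _|mu L mu0 muL _ _]; apply: aux.
- by rewrite mul0r mulr1 sub0r oppr_eq0 oner_eq0.
- lra.
- by exists 0; lra.
- by rewrite mulr0 sub0r oppr_eq0 mulf_neq0 ?gt_eqF.
- lra.
- by exists 0; lra.
- by rewrite mul0r mulr1 sub0r oppr_eq0 oner_eq0.
- lra.
- by exists mu; lra.
- have -> : -2 * (-2 * mu * L) - (mu + L) * (mu + L) = - (L - mu) ^+ 2 by ring.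
  by rewrite oppr_eq0 expf_neq0// subr_eq0 gt_eqF.
- have : 0 < mu * L by rewrite mulr_gt0// (lt_trans mu0).
  lra.
- by exists mu; rewrite le_eqVlt; apply/orP; left; apply/eqP; ring.
Qed.

Lemma balanced_scale d (Th : 'M[R]_(d + d)) c : 0 < c ->
  balanced_multiplier Th -> balanced_multiplier (c *: Th).
Proof.
move=> c0 [Ts Tu Tn [g Tg]].
have E v : quadform (c *: Th) v = c * quadform Th v.
  by rewrite !quadformE -scalemxAl dotZr.
split.
- by rewrite linearZ /= Ts.
- by rewrite unitmxZ// unitfE gt_eqF.
- by move=> x /Tn; rewrite E pmulr_rlt0.
- by exists g => x; rewrite E mulr_ge0// ltW.
Qed.

Lemma daug_mul d e (X : 'M[R]_(d + d)) (Y : 'M[R]_(e + e)) a1 a2 b1 b2 :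
  daug X Y *m (col_mx (col_mx a1 a2) (col_mx b1 b2)) =
  col_mx (col_mx (usubmx (X *m col_mx a1 b1)) (usubmx (Y *m col_mx a2 b2)))
         (col_mx (dsubmx (X *m col_mx a1 b1)) (dsubmx (Y *m col_mx a2 b2)) : 'cV[R]_(d + e)).
Proof.
rewrite -{2 3}[X]submxK -{2 3}[Y]submxK !mul_block_col !col_mxKu !col_mxKd.
by rewrite !mul0mx !(addr0, add0r) !add_col_mx.
Qed.

Lemma daug_quadform d e (X : 'M[R]_(d + d)) (Y : 'M[R]_(e + e)) a1 a2 b1 b2 :
  quadform (daug X Y) (col_mx (col_mx a1 a2) (col_mx b1 b2)) =
  quadform X (col_mx a1 b1) + quadform Y (col_mx a2 b2).
Proof.
rewrite !quadformE daug_mul !dot_col -[X in _ = dot _ X + _]vsubmxK.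
by rewrite -[X in _ = _ + dot _ X]vsubmxK !dot_col addrACA.
Qed.

Lemma daug_balanced d e (X : 'M[R]_(d + d)) (Y : 'M[R]_(e + e)) :
  balanced_multiplier X -> balanced_multiplier Y ->
  [/\ (daug X Y)^T = daug X Y, daug X Y \in unitmx &
      forall x, x != 0 -> quadform (daug X Y) (col_mx x (- x)) < 0].
Proof.
move=> [Xs Xu Xn _] [Ys Yu Yn _]; split.
- rewrite /daug /bdiag !tr_block_mx !trmx0.
  by rewrite !trmx_ulsub !trmx_ursub !trmx_dlsub !trmx_drsub Xs Ys.
- apply: injmx_unit => v.
  rewrite -[v]vsubmxK -[usubmx v]vsubmxK -[dsubmx v]vsubmxK daug_mul.
  move: (usubmx (usubmx v)) (dsubmx (usubmx v)) (usubmx (dsubmx v)) (dsubmx (dsubmx v)).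
  move=> a1 a2 b1 b2; rewrite -[X in _ = X]col_mx0 => /eq_col_mx[].
  rewrite -[X in _ = X]col_mx0 => /eq_col_mx[x1 y1].
  rewrite -[X in _ = X]col_mx0 => /eq_col_mx[x2 y2].
  have := vsubmxK (X *m col_mx a1 b1); rewrite x1 x2 col_mx0 => /esym.
  move/(congr1 (mulmx (invmx X))); rewrite mulKmx// mulmx0 -[X in _ = X -> _]col_mx0.
  move=> /eq_col_mx[-> ->].
  have := vsubmxK (Y *m col_mx a2 b2); rewrite y1 y2 col_mx0 => /esym.
  move/(congr1 (mulmx (invmx Y))); rewrite mulKmx// mulmx0 -[X in _ = X -> _]col_mx0.
  by move=> /eq_col_mx[-> ->]; rewrite !col_mx0.
- move=> x; rewrite -[x]vsubmxK; move: (usubmx x) (dsubmx x) => a b.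
  rewrite col_mx_eq0 negb_and opp_col_mx daug_quadform.
  have Xge w : quadform X (col_mx w (- w)) <= 0.
    by have [->|/Xn/ltW//] := eqVneq w 0; rewrite oppr0 col_mx0 quadformE dot0l.
  have Yge w : quadform Y (col_mx w (- w)) <= 0.
    by have [->|/Yn/ltW//] := eqVneq w 0; rewrite oppr0 col_mx0 quadformE dot0l.
  by case/orP => [/Xn|/Yn]; have := Xge a; have := Yge b; lra.
Qed.
End Dualization.

(** * Incremental sector constraints of convex gradients *)

Section Gradient.
Variable R : realType.

Lemma is_derive_line (V W : normedModType R) (f : V -> W) (x v : V) (t : R) df :
  is_derive (x + t *: v) v f df -> is_derive t (1 : R) (fun s => f (x + s *: v)) df.
Proof.
move=> [fd fv].
have E : (fun h : R => h^-1 *: ((f \o shift (x + t *: v)) (h *: v) - f (x + t *: v))) =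
    (fun h : R => h^-1 *: (((fun s : R => f (x + s *: v)) \o shift t) (h *: 1)
                           - f (x + t *: v))).
  apply/funext => h /=; congr (_ *: (f _ - _)).
  by rewrite [h *: 1]mulr1 scalerDl addrCA.
by split; [rewrite /derivable -E | rewrite /derive -E].
Qed.

Lemma diff_dot_grad d (f : 'cV[R]_d -> R) (x v : 'cV[R]_d) :
  differentiable f x -> 'd f x v = dot (grad f x) v.
Proof.
move=> df; rewrite dotE.
have {1}-> : v = \sum_i v i 0 *: delta_mx i 0.
  by rewrite {1}[v]matrix_sum_delta; apply: eq_bigr => i _; rewrite big_ord1.
rewrite linear_sum; apply: eq_bigr => i _.
by rewrite linearZ mxE deriveE// mulrC.
Qed.

Lemma is_derive_segment d (f : 'cV[R]_d -> R) (x v : 'cV[R]_d) (t : R) :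
  differentiable f (x + t *: v) ->
  is_derive t (1 : R) (fun s => f (x + s *: v)) (dot (grad f (x + t *: v)) v).
Proof.
move=> df; apply: is_derive_line; rewrite -diff_dot_grad// -deriveE//.
exact/derivableP/diff_derivable.
Qed.

Lemma is_derive_subquad (F : R -> R) a (c k t : R) :
  is_derive t (1 : R) F a ->
  is_derive t (1 : R) (fun s => F s - c * s - k * s ^+ 2) (a - c - 2 * k * t).
Proof.
move=> hF.
have h : is_derive t (1 : R) (F - c *: (id : R -> R) - k *: ((id : R -> R) * id))
    (a - c *: 1 - k *: (t *: 1 + t *: 1)) by apply: is_deriveB.
by apply: is_derive_eq h _; rewrite /GRing.scale /=; ring.
Qed.

Lemma is_derive_max0 (f : R -> R) (a : R) : is_derive (0 : R) (1 : R) f a ->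
  (forall t, 0 <= t <= 1 -> f t <= f 0) -> a <= 0.
Proof.
move=> [fd fv] fle.
have : (fun h : R => h^-1 *: ((f \o shift 0) (h *: 1) - f 0)) @ 0^'+ --> a.
  by rewrite -fv; apply: cvg_dnbhs_at_right.
move/cvgr_to_le; apply; near=> h.
have h0 : 0 < h by near: h; exact: nbhs_right_gt.
have h1 : h <= 1 by near: h; exact: nbhs_right_le.
rewrite /= addr0 [h *: 1]mulr1.
have -> : h^-1 *: (f h - f 0) = h^-1 * (f h - f 0) by [].
rewrite pmulr_rle0 ?invr_gt0// subr_le0.
by apply: fle; rewrite ltW.
Unshelve. all: by end_near. Qed.

Lemma enorm2 d (x : 'cV[R]_d) : enorm x ^+ 2 = dot x x.
Proof.
rewrite /enorm sqr_sqrtr; first by rewrite dotE; apply: eq_bigr => i _; rewrite expr2.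
by rewrite sumr_ge0// => i _; rewrite sqr_ge0.
Qed.

Lemma enormZ d c (x : 'cV[R]_d) : enorm (c *: x) = `|c| * enorm x.
Proof.
apply/eqP; rewrite -(@eqrXn2 _ 2) ?mulr_ge0 ?sqrtr_ge0//.
by rewrite exprMn !enorm2 dotZl dotZr real_normK ?num_real// mulrA expr2.
Qed.

Lemma dot_enorm d (x y : 'cV[R]_d) : dot x y <= enorm x * enorm y.
Proof.
have [xy|xy] := ltP (dot x y) 0.
  by rewrite (le_trans (ltW xy))// mulr_ge0 ?sqrtr_ge0.
by rewrite -ler_sqr ?nnegrE ?mulr_ge0 ?sqrtr_ge0// exprMn !enorm2 dot_cauchy.
Qed.

Lemma convex_strongly_convex d (D : set 'cV[R]_d) f :
  convex_on D f -> strongly_convex_on 0 D f.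
Proof.
move=> cf x y t Dx Dy t01; rewrite !mul0r subr0.
move: t01 => /andP[t0 t1].
by have := cf (Itv01 t0 t1) x y; rewrite !inE => /(_ Dx Dy).
Qed.

(** Convexity of the interior, together with a uniform tube around the
    segment: the ball around a point of the segment is a convex combination of
    the balls around the end points. *)
Lemma convex_tube d (U : set 'cV[R]_d) x y :
  @convex_set R 'cV[R]_d U -> U° x -> U° y ->
  exists2 r, 0 < r & forall (t : R) w, 0 <= t <= 1 -> `|w| < r ->
    U° (x + t *: (y - x) + w).
Proof.
move=> cU /nbhs_ballP[r1 /= r10 H1] /nbhs_ballP[r2 /= r20 H2].
exists (Num.min r1 r2) => [|t w /andP[t0 t1] wr]; first by rewrite lt_min r10.
have HU w' : `|w'| < Num.min r1 r2 -> U (x + t *: (y - x) + w').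
  rewrite lt_min => /andP[w1 w2].
  have Ux : U (x + w') by apply: H1; rewrite -ball_normE /= opprD addNKr normrN.
  have Uy : U (y + w') by apply: H2; rewrite -ball_normE /= opprD addNKr normrN.
  have : U (t *: (y + w') + (1 - t) *: (x + w')).
    by have := cU (y + w') (x + w') (Itv01 t0 t1); rewrite !inE; apply.
  by congr U; apply/matrixP => i j; rewrite !mxE; ring.
apply/nbhs_ballP; exists (Num.min r1 r2 - `|w|); first by rewrite /= subr_gt0.
move=> z; rewrite -ball_normE /= => zw.
rewrite -[z](subrK (x + t *: (y - x))) addrC; apply: HU.
have -> : z - (x + t *: (y - x)) = - (x + t *: (y - x) + w - z - w).
  by apply/matrixP => i j; rewrite !mxE; ring.
rewrite normrN.
by rewrite (le_lt_trans (ler_normB _ _))// -ltrBrDr.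
Qed.

(** The convexity inequality along the segment is an equality at [x], so that
    both sides can be differentiated there. *)
Lemma strongly_convex_tangent d mu (D : set 'cV[R]_d) f x y :
  strongly_convex_on mu D f -> D x -> D y -> differentiable f x ->
  f x + dot (grad f x) (y - x) + mu / 2 * dot (y - x) (y - x) <= f y.
Proof.
move=> sc Dx Dy df; set v := y - x.
pose c := f y - f x - mu / 2 * dot v v.
pose psi (t : R) := f (x + t *: v) - c * t - mu / 2 * dot v v * t ^+ 2.
have D0 : is_derive (0 : R) (1 : R) psi (dot (grad f x) v - c).
  have h : is_derive (0 : R) (1 : R) (fun t => f (x + t *: v)) (dot (grad f x) v).
    have := @is_derive_segment d f x v 0; rewrite scale0r addr0; exact.
  by apply: is_derive_eq (is_derive_subquad _ _ h) _; rewrite mulr0 subr0.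
have := is_derive_max0 D0; rewrite -/c => H.
suff : dot (grad f x) v - c <= 0 by rewrite /c; lra.
apply: H => t t01; rewrite /psi scale0r addr0 expr0n /= !mulr0 !subr0.
have := sc y x t Dy Dx t01; rewrite enorm2 -/v.
have -> : t *: y + (1 - t) *: x = x + t *: v.
  by apply/matrixP => i j; rewrite /v !mxE; ring.
rewrite /c; lra.
Qed.

(** The difference of both sides along the segment is nonincreasing, by the
    Cauchy-Schwarz inequality and the Lipschitz bound on the gradient. *)
Lemma descent d L (D : set 'cV[R]_d) f x y :
  eucl_lipschitz_on L D (grad f) ->
  (forall t : R, 0 <= t <= 1 -> D (x + t *: (y - x))) ->
  (forall z, D z -> differentiable f z) ->
  f y <= f x + dot (grad f x) (y - x) + L / 2 * dot (y - x) (y - x).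
Proof.
move=> lip seg df; set v := y - x.
pose c := dot (grad f x) v.
pose g (t : R) := f (x + t *: v) - c * t - L / 2 * dot v v * t ^+ 2.
have dg t : 0 <= t <= 1 ->
    is_derive (t : R) (1 : R) g (dot (grad f (x + t *: v)) v - c - L * dot v v * t).
  move=> t01.
  have h := @is_derive_segment d f x v t (df _ (seg _ t01)).
  by apply: is_derive_eq (is_derive_subquad _ _ h) _; field.
have Dx : D x by have := seg 0; rewrite scale0r addr0 lexx ler01; exact.
have g10 : g 1 <= g 0.
  have in01 t : t \in `]0, 1[%R -> 0 <= t <= 1.
    by rewrite in_itv/= => /andP[/ltW-> /ltW->].
  apply: (@ler0_derive1_le_cc R g 0 1); rewrite ?in_itv/= ?lexx ?ler01//.
  - by move=> t /in01/dg[].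
  - move=> t /in01 t01; rewrite derive1E (@derive_val _ _ _ _ _ _ _ (dg t t01)).
    have := lip (x + t *: v) x (seg t t01) Dx.
    have -> : x + t *: v - x = t *: v by rewrite addrAC subrr add0r.
    move=> l.
    have := dot_enorm (grad f (x + t *: v) - grad f x) v.
    have vt : enorm (t *: v) * enorm v = t * dot v v.
      by rewrite enormZ ger0_norm ?(andP t01).1// -mulrA -expr2 enorm2.
    have : enorm (grad f (x + t *: v) - grad f x) * enorm v <= L * (t * dot v v).
      by rewrite -vt mulrA ler_wpM2r ?sqrtr_ge0.
    rewrite dotDl dotNl -/c; lra.
  - apply: derivable_within_continuous => t; rewrite in_itv/= => /dg[].
    by [].
move: g10; rewrite /g scale0r addr0 scale1r expr1n expr0n /= !mulr0 !subr0 !mulr1.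
by rewrite [x + v]addrC /v subrK -/v /c; lra.
Qed.

(** One step of the Baillon-Haddad argument for [f - mu/2 |.|^2]: the tangent
    inequality at one point and the descent inequality at the other are
    compared at an auxiliary point [z], which has to belong to the domain. *)
Lemma cocoercive_step d mu L (D : set 'cV[R]_d) f x y :
  mu < L -> strongly_convex_on mu D f -> eucl_lipschitz_on L D (grad f) ->
  (forall z, D z -> differentiable f z) -> D x -> D y ->
  let p := grad f y - grad f x - mu *: (y - x) in
  (forall t : R, 0 <= t <= 1 -> D (y + t *: (- (L - mu)^-1 *: p))) ->
  f x + dot (grad f x) (y - x) + mu / 2 * dot (y - x) (y - x)
    + (L - mu)^-1 / 2 * dot p p <= f y.
Proof.
move=> muL sc lip df Dx Dy p seg.
set s := (L - mu)^-1; have s0 : 0 < s by rewrite invr_gt0 subr_gt0.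
pose z := y + - s *: p.
have zy : z - y = - s *: p by rewrite /z addrAC subrr add0r.
have zx : z - x = (y - x) - s *: p by rewrite /z scaleNr addrAC.
have Dz : D z by have := seg 1; rewrite scale1r ler01 lexx; exact.
have lo := strongly_convex_tangent sc Dx Dz (df _ Dx).
have up := @descent d L D f y z lip; rewrite zy in up.
have {}up := up seg df.
have sL : s * (L - mu) = 1 by rewrite mulVf// subr_eq0 gt_eqF.
have gy : grad f y = grad f x + p + mu *: (y - x) by apply/matrixP => i j; rewrite /p !mxE; ring.
rewrite zx gy in lo up; move: lo up; rewrite -/s; clearbody p.
move: (y - x) (grad f x) => v g.
rewrite !dot_expand (dotC v p).
move: (dot p p) => pp lo up.
have e : s * (s * pp) * (L - mu) = s * pp by rewrite -[RHS]mul1r -sL; ring.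
lra.
Qed.

Lemma cocoercive_pair d mu L (D : set 'cV[R]_d) f x y :
  mu < L -> strongly_convex_on mu D f -> eucl_lipschitz_on L D (grad f) ->
  (forall z, D z -> differentiable f z) -> D x -> D y ->
  let p := grad f y - grad f x - mu *: (y - x) in
  (forall t : R, 0 <= t <= 1 -> D (y + - (t * (L - mu)^-1) *: p)) ->
  (forall t : R, 0 <= t <= 1 -> D (x + (t * (L - mu)^-1) *: p)) ->
  dot p p <= (L - mu) * dot p (y - x).
Proof.
move=> muL sc lip df Dx Dy p sy sx.
have h1 := cocoercive_step muL sc lip df Dx Dy.
have h2 := cocoercive_step muL sc lip df Dy Dx.
have pN : grad f x - grad f y - mu *: (x - y) = - p.
  by apply/matrixP => i j; rewrite /p !mxE; ring.
rewrite -/p pN -[x - y]opprB in h1 h2.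
have {}h1 := h1 (fun t t01 => ltac:(by rewrite scalerA mulrN; exact: sy)).
have {}h2 := h2 (fun t t01 => ltac:(by rewrite scalerN scaleNr opprK scalerA; exact: sx)).
have Lm : 0 < L - mu by rewrite subr_gt0.
rewrite -(ler_pM2l (_ : 0 < (L - mu)^-1)) ?invr_gt0// mulrA mulVf ?gt_eqF// mul1r.
have e : dot p (y - x) = dot (grad f y) (y - x) - dot (grad f x) (y - x)
                         - mu * dot (y - x) (y - x).
  by rewrite {1}/p !(dotDl, dotNl, dotZl).
rewrite e; move: h1 h2; rewrite !(dotNl, dotNr, opprK); lra.
Qed.

Lemma dot_subZ d mu (a h : 'cV[R]_d) :
  dot (a - mu *: h) (a - mu *: h) <= 2 * dot a a + 2 * mu ^+ 2 * dot h h.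
Proof.
have := dot_ge0 (a + mu *: h); rewrite !dot_expand (dotC h a); lra.
Qed.

(** The Baillon-Haddad theorem on an open convex set.  The auxiliary points of
    the classical argument may leave the set, so that argument only applies to
    nearby points; the inequality for the increments of the gradient of
    [f - mu/2 |.|^2] passes to the sum of the steps of an equipartition of
    the segment, since
    [|a + b|^2 <= (1 + 1/k) |a|^2 + (1 + k) |b|^2]. *)
Lemma cocoercive d mu L (U : set 'cV[R]_d) f x y :
  mu < L -> @convex_set R 'cV[R]_d U ->
  strongly_convex_on mu U° f -> eucl_lipschitz_on L U° (grad f) ->
  (forall z, U° z -> differentiable f z) -> U° x -> U° y ->
  forall p, p = grad f y - grad f x - mu *: (y - x) ->
  dot p p <= (L - mu) * dot p (y - x).
Proof.
move=> muL cU sc lip df Dx Dy p pD.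
have [rho rho0 tube] := convex_tube cU Dx Dy.
have Lm : 0 < L - mu by rewrite subr_gt0.
set q := y - x in pD tube *; set s := (L - mu)^-1.
pose G z := grad f z - mu *: z.
have pE : p = G y - G x.
  by apply/matrixP => i j; rewrite pD /G /q !mxE; ring.
(* [b / N^2] bounds the squared distance to the auxiliary points of one step of
   the partition into [N] pieces; it has to be less than [rho^2]. *)
pose b := s ^+ 2 * (2 * L ^+ 2 + 2 * mu ^+ 2) * dot q q.
have b0 : 0 <= b.
  rewrite mulr_ge0 ?dot_ge0// mulr_ge0 ?sqr_ge0//.
  by have := sqr_ge0 L; have := sqr_ge0 mu; lra.
pose N := (Num.bound (b / rho ^+ 2)).+1.
have N0 : 0 < N%:R :> R by rewrite ltr0n.
have bN : b / N%:R ^+ 2 < rho ^+ 2.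
  rewrite ltr_pdivrMr ?exprn_gt0// mulrC -ltr_pdivrMr ?exprn_gt0//.
  rewrite (@lt_le_trans _ _ N%:R)//.
    rewrite (lt_le_trans (archi_boundP _)) ?ler_nat//.
    by rewrite divr_ge0// sqr_ge0.
  by rewrite expr2 ler_peMr ?ler1n ?ltW.
pose h := N%:R^-1 *: q; pose X (k : nat) := x + (k%:R / N%:R) *: q.
have X01 k : (k <= N)%N -> 0 <= (k%:R / N%:R : R) <= 1.
  by move=> kN; rewrite divr_ge0//= ler_pdivrMr// mul1r ler_nat.
have XS k : X k.+1 - X k = h.
  apply/matrixP => i j; rewrite /X /h !mxE -natr1; ring.
have DX k w : (k <= N)%N -> `|w| < rho -> U° (X k + w).
  by move=> kN wr; exact: tube (X01 _ kN) wr.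
have DX0 k : (k <= N)%N -> U° (X k).
  by move=> kN; rewrite -[X k]addr0; apply: DX => //; rewrite normr0.
have step k : (k < N)%N ->
    dot (G (X k.+1) - G (X k)) (G (X k.+1) - G (X k)) <=
    (L - mu) * dot (G (X k.+1) - G (X k)) h.
  move=> kN.
  have GE : G (X k.+1) - G (X k) =
      grad f (X k.+1) - grad f (X k) - mu *: (X k.+1 - X k).
    by apply/matrixP => i j; rewrite /G !mxE; ring.
  have := @cocoercive_pair d mu L U° f (X k) (X k.+1) muL sc lip df
    (DX0 k (ltnW kN)) (DX0 k.+1 kN).
  rewrite -GE XS; set pk := G (X k.+1) - G (X k) in GE *.
  have pkb : `|s *: pk| < rho.
    rewrite -ltr_sqr ?nnegrE ?normr_ge0 ?(ltW rho0)//; apply: (le_lt_trans (normr_dot _)).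
    apply: le_lt_trans bN.
    have -> : b / N%:R ^+ 2 = s ^+ 2 * ((2 * L ^+ 2 + 2 * mu ^+ 2) * dot h h).
      by rewrite /b /h dotZl dotZr; field; rewrite gt_eqF.
    rewrite dotZl dotZr mulrA -expr2 ler_wpM2l ?sqr_ge0//.
    have lp := lip _ _ (DX0 k.+1 kN) (DX0 k (ltnW kN)); rewrite XS in lp.
    have {}lp : dot (grad f (X k.+1) - grad f (X k)) (grad f (X k.+1) - grad f (X k))
        <= L ^+ 2 * dot h h.
      rewrite -!enorm2 -exprMn ler_sqr ?nnegrE ?sqrtr_ge0//.
      by rewrite (le_trans _ lp) ?sqrtr_ge0.
    rewrite GE XS; apply: (le_trans (dot_subZ _ _ _)).
    clearbody h; lra.
  have small t : 0 <= t <= 1 -> `|(t * s) *: pk| < rho.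
    move=> /andP[t0 t1]; rewrite -scalerA normrZ ger0_norm//.
    by rewrite (le_lt_trans _ pkb)// ler_piMl.
  apply=> t t01; apply: DX; rewrite ?small ?(ltnW kN)//.
  by rewrite scaleNr normrN small.
have tele k : (k <= N)%N ->
    dot (G (X k) - G (X 0)) (G (X k) - G (X 0)) <=
    k%:R * (L - mu) * dot (G (X k) - G (X 0)) h.
  elim: k => [_|k IH kN]; first by rewrite subrr !dot0l mulr0.
  have -> : G (X k.+1) - G (X 0) = (G (X k) - G (X 0)) + (G (X k.+1) - G (X k)).
    by rewrite [RHS]addrC addrA subrK.
  move: (step k kN) (IH (ltnW kN)).
  move: (G (X k) - G (X 0)) (G (X k.+1) - G (X k)) => a c hc ha.
  have [k0|k0] := posnP k.
    move: ha; rewrite k0 !mul0r => ha.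
    have -> : a = 0 by apply/eqP; rewrite -dot_eq0; apply/eqP/le_anti; rewrite ha dot_ge0.
    by rewrite !add0r mul1r.
  have k0' : 0 < k%:R :> R by rewrite ltr0n.
  have yg := dot_young a c (_ : 0 < k%:R^-1); rewrite invr_gt0 invrK in yg.
  have {}yg := yg k0'.
  have ha' : k%:R^-1 * dot a a <= (L - mu) * dot a h.
    by rewrite ler_pdivrMl// mulrA.
  have hc' : k%:R * dot c c <= k%:R * ((L - mu) * dot c h) by rewrite ler_pM2l.
  rewrite -natr1 !(dotDl, dotDr) (dotC c a); lra.
have X0 : X 0 = x by rewrite /X mul0r scale0r addr0.
have XN : X N = y by rewrite /X divff ?gt_eqF// scale1r /q addrC subrK.
have := tele N (leqnn _); rewrite X0 XN -pE.
have -> : N%:R * (L - mu) * dot p h = (L - mu) * dot p q; last by [].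
by rewrite /h dotZr mulrAC -mulrA mulrCA [N%:R^-1 * _]mulrC; field; rewrite gt_eqF.
Qed.

Lemma strongly_convex_monotone d mu (D : set 'cV[R]_d) f x y :
  strongly_convex_on mu D f -> D x -> D y ->
  (forall z, D z -> differentiable f z) ->
  mu * dot (y - x) (y - x) <= dot (grad f y - grad f x) (y - x).
Proof.
move=> sc Dx Dy df.
have := strongly_convex_tangent sc Dx Dy (df _ Dx).
have := strongly_convex_tangent sc Dy Dx (df _ Dy).
rewrite -[x - y]opprB !(dotDl, dotNl, dotNr, opprK); lra.
Qed.

(** Strong monotonicity of the gradient for the nonsmooth classes, cocoercivity
    for the smooth ones, plain convexity being the case [mu = 0]. *)
Lemma class_sector d (U : set 'cV[R]_d) phi Th x y :
  @convex_set R 'cV[R]_d U -> (forall z, U° z -> differentiable phi z) ->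
  class_multiplier U° phi Th -> U° x -> U° y ->
  0 <= quadform Th (col_mx (grad phi y - grad phi x) (y - x)).
Proof.
move=> cU df + Dx Dy; case=> [cf|L L0 cf lip|mu mu0 sc|mu L mu0 muL sc lip];
  rewrite kron2I_quadform.
- have := strongly_convex_monotone (convex_strongly_convex cf) Dx Dy df; lra.
- have := cocoercive L0 cU (convex_strongly_convex cf) lip df Dx Dy erefl.
  rewrite scale0r !subr0; lra.
- have := strongly_convex_monotone sc Dx Dy df; lra.
- have := cocoercive muL cU sc lip df Dx Dy erefl.
  move: (grad phi y - grad phi x) (y - x) => dl v.
  rewrite !dot_expand (dotC v dl); lra.
Qed.
End Gradient.

(** * The Cauchy-Lipschitz theorem *)

Section Cauchy_Lipschitz.
Variable R : realType.
Notation mu := (@lebesgue_measure R).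

(** Extending the primitive by 0 to the left of 0 makes it continuous on the whole
    line and differentiable at every positive time. *)
Definition prim0 (f : R -> R) (t : R) : R := parameterized_integral mu 0 t f.

Lemma continuous_integrable (f : R -> R) (a b : R) :
  continuous f -> mu.-integrable `[a, b] (EFin \o f).
Proof.
move=> cf; apply: continuous_compact_integrable; first exact: segment_compact.
exact: continuous_subspaceT.
Qed.

Lemma prim0_le0 (f : R -> R) (t : R) : t <= 0 -> prim0 f t = 0.
Proof.
rewrite /prim0 /parameterized_integral le_eqVlt => /predU1P[->|t0].
  by rewrite set_itv1 Rintegral_set1.
by rewrite set_itv_ge ?Rintegral_set0// -leNgt bnd_simp.
Qed.

Lemma is_derive_prim0 (f : R -> R) (t : R) : continuous f -> 0 < t ->
  is_derive t (1 : R) (prim0 f) (f t).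
Proof.
move=> cf t0.
have t1 : t < t + 1 by rewrite ltrDl.
have [h1 h2] := @continuous_FTC1_closed R f 0 t (t + 1) t1
  (continuous_integrable _ _ cf) t0 (cf t).
by split; [exact: h1 | rewrite -h2 derive1E].
Qed.

Lemma continuous_prim0 (f : R -> R) : continuous f -> continuous (prim0 f).
Proof.
move=> cf t; have [t0|t0|t0] := ltgtP t 0.
- rewrite /continuous_at (prim0_le0 _ (ltW t0)); apply: cvg_near_cst; near=> s.
  by rewrite prim0_le0// ltW//; near: s; exact: lt_nbhsl.
- apply/differentiable_continuous/derivable1_diffP.
  by have [] := is_derive_prim0 cf t0.
- rewrite t0 /continuous_at (prim0_le0 f (lexx 0)).
  exact: (@parameterized_integral_cvg_left R 0 1 f ltr01 (continuous_integrable _ _ cf)).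
Unshelve. all: by end_near. Qed.

Section Vector.
Variable d : nat.

Lemma continuous_col (f : R -> 'cV[R]_d) (t : R) :
  (forall i, {for t, continuous (fun s => f s i 0)}) -> {for t, continuous f}.
Proof.
move=> cf; apply/cvgrPdist_lt => e e0; near=> s.
rewrite [ltLHS]/Num.norm /= mx_normrE.
apply: (big_ind (fun x => x < e)) => // [x y xe ye|[i j] _].
  by rewrite gt_max xe.
rewrite ord1 !mxE /=; move: i; near: s; apply: filter_forall => i.
have := (cvgrPdist_lt _ _).1 (cf i) e e0; exact.
Unshelve. all: by end_near. Qed.

Lemma is_derive_col (f : R -> 'cV[R]_d) (t : R) (a : 'cV[R]_d) :
  (forall i, is_derive t (1 : R) (fun s => f s i 0) (a i 0)) ->
  is_derive t (1 : R) f a.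
Proof.
move=> df; have fd : derivable f t 1.
  by apply/derivable_mxP => i j; rewrite ord1; have [] := df i.
split=> //; rewrite derive_mx//; apply/matrixP => i j; rewrite mxE ord1.
by have [] := df i.
Qed.

Lemma is_derive_coord (f : R -> 'cV[R]_d) (t : R) (a : 'cV[R]_d) i :
  is_derive t (1 : R) f a -> is_derive t (1 : R) (fun s => f s i 0) (a i 0).
Proof.
move=> [fd <-]; rewrite derive_mx// mxE.
by apply: derivableP; move/derivable_mxP: fd; exact.
Qed.

Definition vprim0 (f : R -> 'cV[R]_d) (t : R) : 'cV[R]_d :=
  \col_i prim0 (fun s => f s i 0) t.

Lemma continuous_coord (f : R -> 'cV[R]_d) i :
  continuous f -> continuous (fun s => f s i 0).
Proof.
move=> cf t; apply: (@continuous_comp _ _ _ f (fun M : 'cV[R]_d => M i 0)) .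
  exact: cf.
exact: coord_continuous.
Qed.

Lemma vprim0_le0 f (t : R) : t <= 0 -> vprim0 f t = 0.
Proof. by move=> t0; apply/matrixP => i j; rewrite !mxE prim0_le0. Qed.

Lemma continuous_vprim0 f : continuous f -> continuous (vprim0 f).
Proof.
move=> cf t; apply: continuous_col => i.
have -> : (fun s => vprim0 f s i 0) = prim0 (fun s => f s i 0).
  by apply/funext => s; rewrite mxE.
exact/continuous_prim0/continuous_coord.
Qed.

Lemma is_derive_vprim0 f (t : R) : continuous f -> 0 < t ->
  is_derive t (1 : R) (vprim0 f) (f t).
Proof.
move=> cf t0; apply: is_derive_col => i.
have -> : (fun s => vprim0 f s i 0) = prim0 (fun s => f s i 0).
  by apply/funext => s; rewrite mxE.
by apply: (@is_derive_prim0 (fun s => f s i 0)) => //; exact: continuous_coord.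
Qed.

(** The weight [expR (K t)] turns the Picard operator into a contraction on
    the whole half-line, since integrating it from 0 divides it by [K].  The
    functions to be compared agree for nonpositive times, so that the bound holds
    on the whole line. *)
Lemma exp_weight_bound (g g' : R -> 'cV[R]_d) (c K : R) : 0 < K -> 0 <= c ->
  continuous g -> (forall t : R, t <= 0 -> g t = 0) ->
  (forall t : R, 0 < t -> is_derive t (1 : R) g (g' t)) ->
  (forall t : R, 0 < t -> `|g' t| <= c * expR (K * t)) ->
  forall t, `|g t| <= c / K * expR (K * t).
Proof.
move=> K0 c0 cg g0 dg g'b t.
have w0 s : 0 <= c / K * expR (K * s) by rewrite mulr_ge0 ?expR_ge0// divr_ge0// ltW.
have [t0|t0] := leP t 0; first by rewrite g0// normr0.
rewrite [leLHS]/Num.norm /= mx_normrE.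
apply: bigmax_le => // -[i j] _ /=; rewrite ord1.
have key (e : R) : e = 1 \/ e = -1 -> 0 <= c / K * expR (K * t) + e * g t i 0.
  move=> e1; pose phi s := c / K * expR (K * s) + e * g s i 0.
  have dw s : is_derive s (1 : R) (fun s => c / K * expR (K * s)) (c * expR (K * s)).
    have h1 : is_derive s (1 : R) (K *: (id : R -> R)) (K *: 1).
      exact: is_deriveZ.
    have h2 := is_derive1_comp (is_derive_expR (K * s)) h1.
    have h3 := @is_deriveZ _ _ _ _ (c / K) _ _ _ h2.
    apply: (is_derive_eq h3); rewrite /GRing.scale /=; field; exact: lt0r_neq0.
  have dphi (s : R) : 0 < s -> is_derive s (1 : R) phi (c * expR (K * s) + e * g' s i 0).
    move=> s0; have h := is_derive_coord i (dg s s0).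
    exact: (is_deriveD (dw s) (@is_deriveZ _ _ _ _ e _ _ _ h)).
  have in0 s : s \in `]0, t[ -> 0 < s by rewrite in_itv/= => /andP[].
  have : phi 0 <= phi t.
    have m0 : (0 : R) \in `[0, t]%R by rewrite in_itv/= lexx (ltW t0).
    have mt : t \in `[0, t]%R by rewrite in_itv/= lexx (ltW t0).
    apply: (@ger0_derive1_le_cc R phi 0 t _ _ _ 0 t m0 mt (ltW t0)).
    - by move=> s /in0/dphi[].
    - move=> s /in0 s0; rewrite derive1E (@derive_val _ _ _ _ _ _ _ (dphi s s0)).
      have b : `|g' s i 0| <= c * expR (K * s).
        exact: le_trans (normr_coord _ _) (g'b s s0).
      move: b; rewrite ler_norml => /andP[b1 b2].
      by case: e1 => ->; rewrite ?mul1r ?mulN1r; lra.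
    - have cw : continuous (fun s : R => c / K * expR (K * s)).
        by move=> s; apply/differentiable_continuous/derivable1_diffP; have [] := dw s.
      apply: continuous_subspaceT => s.
      apply: (@continuousD _ _ _ (fun s : R => c / K * expR (K * s))
        (fun s : R => e * g s i 0)); first exact: cw.
      by apply: continuousM; [exact: cst_continuous | exact: continuous_coord].
  apply: le_trans; rewrite /phi g0// mxE [e * 0]mulr0 addr0; exact: w0.
have k1 := key 1 (or_introl erefl); have k2 := key (-1) (or_intror erefl).
by rewrite ler_norml; apply/andP; split; lra.
Qed.

Section Picard.
Variables (F : 'cV[R]_d -> 'cV[R]_d) (k : R) (v : 'cV[R]_d).
Hypothesis k0 : 0 < k.
Hypothesis F_lip : forall x y, `|F x - F y| <= k * `|x - y|.

Let K := 2 * k.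
Let K0 : 0 < K. Proof. by rewrite mulr_gt0. Qed.

Lemma lipschitz_continuous : continuous F.
Proof.
move=> x; apply/(@cvgrPdist_lt _ _ _ _ (nbhs_filter x)) => e e0; apply/nbhs_ballP.
exists (e / k); first by rewrite /= divr_gt0.
move=> y; rewrite -ball_normE /= ltr_pdivlMr// mulrC => xy.
exact: le_lt_trans (F_lip x y) xy.
Qed.

Definition picard_op (xi : R -> 'cV[R]_d) (t : R) : 'cV[R]_d :=
  v + vprim0 (F \o xi) t.

Fixpoint picard (n : nat) : R -> 'cV[R]_d :=
  if n is m.+1 then picard_op (picard m) else fun=> v.

Lemma continuous_comp_F (xi : R -> 'cV[R]_d) : continuous xi -> continuous (F \o xi).
Proof.
move=> cx t; apply: continuous_comp; first exact: cx.
exact: lipschitz_continuous.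
Qed.

Lemma continuous_picard_op (xi : R -> 'cV[R]_d) : continuous xi -> continuous (picard_op xi).
Proof.
move=> cx t; apply: (@continuousD _ _ _ (cst v) (vprim0 (F \o xi))).
  exact: cst_continuous.
exact/continuous_vprim0/continuous_comp_F.
Qed.

Lemma continuous_picard n : continuous (picard n).
Proof.
elim: n => [|n IH]; first by move=> t; exact: cst_continuous.
exact: continuous_picard_op.
Qed.

Lemma is_derive_picard_op (xi : R -> 'cV[R]_d) (t : R) : continuous xi -> 0 < t ->
  is_derive t (1 : R) (picard_op xi) (F (xi t)).
Proof.
move=> cx t0.
have h1 := is_derive_cst v t (1 : R).
have h2 := is_derive_vprim0 (continuous_comp_F cx) t0.
by have := is_deriveD h1 h2; rewrite add0r.
Qed.

Lemma picard_op_contract (xi zeta : R -> 'cV[R]_d) c : 0 <= c -> continuous xi -> continuous zeta ->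
  (forall t : R, `|xi t - zeta t| <= c * expR (K * t)) ->
  forall t : R, `|picard_op xi t - picard_op zeta t| <= c / 2 * expR (K * t).
Proof.
move=> c0 cx cz xz t.
have -> : c / 2 = (k * c) / K by rewrite /K; field; exact: lt0r_neq0.
apply: (@exp_weight_bound (picard_op xi - picard_op zeta)
  (fun s => F (xi s) - F (zeta s))) => //.
- by rewrite mulr_ge0// ltW.
- move=> s; apply: (@continuousB _ _ _ (picard_op xi) (picard_op zeta));
    exact: continuous_picard_op.
- by move=> s s0; rewrite -[LHS]/(picard_op xi s - picard_op zeta s) /picard_op !vprim0_le0// subrr.
- by move=> s s0; apply: is_deriveB; exact: is_derive_picard_op.
- by move=> s s0; apply: le_trans (F_lip _ _) _; rewrite -mulrA ler_pM2l.
Qed.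

Let M := `|F v| / K.

Lemma picard_step n (t : R) :
  `|picard n.+1 t - picard n t| <= M / 2 ^+ n * expR (K * t).
Proof.
have M0 : 0 <= M by rewrite divr_ge0// ltW.
elim: n t => [|n IH] t.
  rewrite expr0 divr1; apply: (@exp_weight_bound (picard 1%N - cst v) (fun=> F v)) => //.
  - move=> s; apply: (@continuousB _ _ _ (picard 1%N) (cst v)).
      exact: (@continuous_picard 1%N).
    exact: cst_continuous.
  - by move=> s s0; rewrite -[LHS]/(picard 1%N s - v) /= /picard_op vprim0_le0// addr0 subrr.
  - move=> s s0; have h1 := is_derive_cst v s (1 : R).
    have h2 := is_derive_picard_op (@continuous_picard 0%N) s0.
    by have := is_deriveB h2 h1; rewrite subr0.
  - move=> s s0; rewrite ler_peMr// -expR0 ler_expR mulr_ge0 ?ltW//.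
have := picard_op_contract _ (@continuous_picard n.+1) (@continuous_picard n) IH t.
rewrite divr_ge0 ?exprn_ge0// => /(_ isT); congr (_ <= _ * _).
by rewrite exprS; field; rewrite expf_neq0 ?pnatr_eq0.
Qed.

Lemma picard_dist n m (t : R) :
  `|picard (n + m) t - picard n t| <= 2 * M / 2 ^+ n * expR (K * t).
Proof.
have M0 : 0 <= M by rewrite divr_ge0// ltW.
suff : `|picard (n + m) t - picard n t| <=
    (2 * M / 2 ^+ n - 2 * M / 2 ^+ (n + m)) * expR (K * t).
  move/le_trans; apply; rewrite ler_wpM2r ?expR_ge0// gerBl divr_ge0 ?exprn_ge0//.
  exact: mulr_ge0.
elim: m => [|m IH]; first by rewrite addn0 !subrr normr0 mul0r.
rewrite addnS -[X in `|X|](subrKA (picard (n + m) t)).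
apply: (le_trans (ler_normD _ _)); apply: (le_trans (lerD (picard_step _ _) IH)).
rewrite -mulrDl ler_wpM2r ?expR_ge0// le_eqVlt; apply/orP; left; apply/eqP.
by rewrite exprS; field; rewrite !expf_neq0 ?pnatr_eq0.
Qed.

(** The Picard iterates converge geometrically at each time, with a rate which is
    uniform up to the weight, hence locally uniform: the limit is continuous,
    and the contraction estimate makes it a fixed point of the Picard
    operator. *)
Lemma global_solution : exists xi : R -> 'cV[R]_d, [/\ continuous xi, xi 0 = v &
  forall t : R, 0 < t -> is_derive t (1 : R) xi (F (xi t))].
Proof.
have M0 : 0 <= M by rewrite divr_ge0// ltW.
have small (e c : R) : 0 < e -> 0 <= c -> exists n, c / 2 ^+ n < e.
  move=> e0 c0; exists (Num.bound (c / e)).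
  rewrite ltr_pdivrMr ?exprn_gt0// mulrC -ltr_pdivrMr//.
  apply: lt_trans (archi_boundP (divr_ge0 c0 (ltW e0))) _.
  by rewrite -natrX ltr_nat ltn_expl.
have cvgp (t : R) : cvg (picard n t @[n --> \oo]).
  apply/cauchy_cvgP/cauchy_exP => e e0.
  have [|n nM] := small e (2 * M * expR (K * t)) e0.
    by rewrite mulr_ge0 ?expR_ge0// mulr_ge0.
  exists (picard n t).
  suff : \forall m \near \oo, ball (picard n t) e (picard m t) by [].
  near=> m; have nm : (n <= m)%N by near: m; exact: nbhs_infty_ge.
  rewrite -ball_normE /= distrC -(subnKC nm); apply: le_lt_trans (picard_dist _ _ _) _.
  by rewrite mulrAC.
pose y (t : R) := lim (picard n t @[n --> \oo]).
have ydist n (t : R) : `|y t - picard n t| <= 2 * M / 2 ^+ n * expR (K * t).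
  apply/ler_addgt0Pr => e e0.
  have /cvgrPdist_lt/(_ e e0) := cvgp t; rewrite -/(y t) => H.
  have [m [nm ym]] : exists m, (n <= m)%N /\ `|y t - picard m t| < e.
    have [m] := filter_ex (filterI H (nbhs_infty_ge n)).
    by case=> ? ?; exists m.
  rewrite -[X in `|X|](subrKA (picard m t)); apply: (le_trans (ler_normD _ _)).
  rewrite addrC lerD ?(ltW ym)// -(subnKC nm).
  exact: picard_dist.
have cy : continuous y.
  move=> t; apply/cvgrPdist_lt => e e0.
  have e3 : 0 < e / 3 by rewrite divr_gt0.
  have [|n nM] := small (e / 3) (2 * M * expR (K * (t + 1))) e3.
    by rewrite mulr_ge0 ?expR_ge0// mulr_ge0.
  have close (s : R) : s < t + 1 -> `|y s - picard n s| < e / 3.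
    move=> st; apply: le_lt_trans (ydist n s) _; apply: le_lt_trans nM.
    have c0 : 0 <= 2 * M / 2 ^+ n.
      by apply: divr_ge0; [exact: mulr_ge0 | exact: exprn_ge0].
    rewrite [leRHS]mulrAC; apply: ler_wpM2l => //.
    by rewrite ler_expR ler_pM2l// ltW.
  near=> s.
  have -> : y t - y s = (y t - picard n t) + (picard n t - picard n s)
                        + (picard n s - y s).
    by rewrite !subrKA.
  have st : s < t + 1 by near: s; apply: lt_nbhsl; rewrite ltrDl.
  have h1 := close t (_ : t < t + 1); have {}h1 : `|y t - picard n t| < e / 3.
    by apply: h1; rewrite ltrDl.
  have h2 := close s st; rewrite distrC in h2.
  have h3 : `|picard n t - picard n s| < e / 3.
    near: s; apply: (cvgrPdist_lt _ _).1; last by rewrite divr_gt0.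
    exact: continuous_picard.
  rewrite (le_lt_trans (ler_normD _ _))//.
  have := ler_normD (y t - picard n t) (picard n t - picard n s); lra.
have yfix : y = picard_op y.
  apply/funext => t; apply/eqP; rewrite -subr_eq0 -normr_le0.
  apply/ler_addgt0Pr => e e0; rewrite add0r.
  have [|n nM] := small e (2 * M * expR (K * t)) e0.
    by rewrite mulr_ge0 ?expR_ge0// mulr_ge0.
  apply: (le_trans _ (ltW nM)).
  have h1 := ydist n.+1 t.
  have c0 : 0 <= 2 * M / 2 ^+ n.
      by apply: divr_ge0; [exact: mulr_ge0 | exact: exprn_ge0].
  have h2 := picard_op_contract c0 cy (@continuous_picard n) (ydist n) t.
  rewrite distrC in h2; rewrite -[X in `|X|](subrKA (picard n.+1 t)).
  apply: (le_trans (ler_normD _ _)); apply: (le_trans (lerD h1 h2)).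
  rewrite -mulrDl [leRHS]mulrAC ler_wpM2r ?expR_ge0// le_eqVlt.
  apply/orP; left; apply/eqP.
  by rewrite exprS; field; rewrite expf_neq0 ?pnatr_eq0.
exists y; split=> // [|t t0].
  by rewrite yfix /picard_op vprim0_le0// addr0.
by rewrite {1}yfix; exact: is_derive_picard_op.
Unshelve. all: by end_near. Qed.
End Picard.
End Vector.
End Cauchy_Lipschitz.

(** * Lyapunov's direct method *)

Section Lyapunov.
Variable R : realType.

Lemma continuous_dot (T : topologicalType) d (f g : T -> 'cV[R]_d) :
  (forall i, continuous (fun s => f s i 0)) -> (forall i, continuous (fun s => g s i 0)) ->
  continuous (fun s => dot (f s) (g s)).
Proof.
move=> cf cg.
have -> : (fun s => dot (f s) (g s)) = \sum_i (fun s => f s i 0 * g s i 0).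
  by apply/funext => s; rewrite dotE fct_sumE.
apply: (big_ind (fun h : T -> R => continuous h)).
- by move=> s; exact: cst_continuous.
- by move=> h1 h2 c1 c2 s; apply: continuousD; [exact: c1|exact: c2].
- by move=> i _ s; apply: continuousM; [exact: cf|exact: cg].
Qed.

Lemma mulmx_coord d p (X : 'M[R]_(d, p)) v i : (X *m v) i 0 = dot (row i X)^T v.
Proof. by rewrite dotE mxE; apply: eq_bigr => j _; rewrite !mxE. Qed.

Lemma continuous_quadform (T : topologicalType) d (X : 'M[R]_d) (f : T -> 'cV[R]_d) :
  (forall i, continuous (fun s => f s i 0)) -> continuous (fun s => quadform X (f s)).
Proof.
move=> cf.
have -> : (fun s => quadform X (f s)) = (fun s => dot (f s) (X *m f s)).
  by apply/funext => s; rewrite quadformE.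
apply: continuous_dot => // i.
have -> : (fun s => (X *m f s) i 0) = (fun s => dot (row i X)^T (f s)).
  by apply/funext => s; rewrite mulmx_coord.
by apply: continuous_dot => // j s; exact: cst_continuous.
Qed.

Lemma is_derive_dot d (f g : R -> 'cV[R]_d) (t : R) (a b : 'cV[R]_d) :
  is_derive t (1 : R) f a -> is_derive t (1 : R) g b ->
  is_derive t (1 : R) (fun s => dot (f s) (g s)) (dot a (g t) + dot (f t) b).
Proof.
move=> df dg.
have -> : (fun s => dot (f s) (g s)) = \sum_i (fun s => f s i 0 * g s i 0).
  by apply/funext => s; rewrite dotE fct_sumE.
have -> : dot a (g t) + dot (f t) b = \sum_i (f t i 0 *: b i 0 + g t i 0 *: a i 0).
  rewrite !dotE -big_split; apply: eq_bigr => i _ /=.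
  by rewrite addrC [a i 0 * _]mulrC.
apply: is_derive_sum => i.
exact: (is_deriveM (is_derive_coord i df) (is_derive_coord i dg)).
Qed.

Lemma is_derive_quadform d (X : 'M[R]_d) (f : R -> 'cV[R]_d) (t : R) (a : 'cV[R]_d) :
  X^T = X -> is_derive t (1 : R) f a ->
  is_derive t (1 : R) (fun s => quadform X (f s)) (2 * dot (f t) (X *m a)).
Proof.
move=> Xs df.
have dX : is_derive t (1 : R) (fun s => X *m f s) (X *m a).
  apply: is_derive_col => i; rewrite mulmx_coord.
  have -> : (fun s => (X *m f s) i 0) = (fun s => dot (row i X)^T (f s)).
    by apply/funext => s; rewrite mulmx_coord.
  have := is_derive_dot (is_derive_cst (row i X)^T t (1 : R)) df.
  by rewrite dot0l add0r.
have -> : (fun s => quadform X (f s)) = (fun s => dot (f s) (X *m f s)).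
  by apply/funext => s; rewrite quadformE.
have := is_derive_dot df dX; congr is_derive.
by rewrite dot_mulmxr Xs dotC mulr_natl mulr2n.
Qed.

Lemma quadform_decay d (X : 'M[R]_d) (f a : R -> 'cV[R]_d) (lam t : R) :
  X^T = X -> 0 <= t -> {within `[0, t], continuous f} ->
  (forall s : R, 0 < s < t -> is_derive s (1 : R) f (a s)) ->
  (forall s : R, 0 < s < t -> 2 * dot (f s) (X *m a s) <= - lam * quadform X (f s)) ->
  quadform X (f t) <= expR (- lam * t) * quadform X (f 0).
Proof.
move=> Xs t0 cf df dec.
pose g (s : R) := expR (lam * s) * quadform X (f s).
have de s : is_derive s (1 : R) (fun s => expR (lam * s)) (lam * expR (lam * s)).
  have h1 : is_derive s (1 : R) (lam *: (id : R -> R)) (lam *: 1) by exact: is_deriveZ.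
  have h2 := is_derive1_comp (is_derive_expR (lam * s)) h1.
  by apply: (is_derive_eq h2); rewrite /GRing.scale /= mulr1 mulrC.
have dg s : 0 < s < t -> is_derive s (1 : R) g
    (expR (lam * s) * (2 * dot (f s) (X *m a s) + lam * quadform X (f s))).
  move=> st; have h : is_derive s (1 : R) g _ :=
    is_deriveM (de s) (is_derive_quadform Xs (df s st)).
  by apply: (is_derive_eq h); rewrite /GRing.scale /=; ring.
have in0 s : s \in `]0, t[ -> 0 < s < t by rewrite in_itv.
have : g t <= g 0.
  apply: (@ler0_derive1_le_cc R g 0 t); rewrite ?in_itv/= ?lexx ?t0//.
  - by move=> s /in0/dg[].
  - move=> s /in0 st; rewrite derive1E (@derive_val _ _ _ _ _ _ _ (dg s st)).
    have := dec s st => h; rewrite pmulr_rle0 ?expR_gt0//; lra.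
  - move=> s; apply: (@continuousM _ (subspace `[0, t]%classic)
      (fun s => expR (lam * s)) (fun s => quadform X (f s))).
      apply: continuous_subspaceT => {}s.
      by apply/differentiable_continuous/derivable1_diffP; have [] := de s.
    apply: continuous_quadform => i {}s.
    apply: (@continuous_comp _ _ _ (f : subspace `[0, t]%classic -> _)
      (fun M : 'cV[R]_d => M i 0)); first exact: cf.
    exact: coord_continuous.
rewrite /g mulr0 expR0 mul1r => h.
by rewrite mulNr expRN ler_pdivlMl ?expR_gt0.
Qed.

Definition radial_gain (V : normedModType R) (rho : R) (x : V) : R :=
  rho / Num.max rho `|x|.

Definition radial (V : normedModType R) (rho : R) (x : V) : V :=
  radial_gain rho x *: x.

Section Radial.
Variables (V : normedModType R) (rho : R).
Hypothesis rho0 : 0 < rho.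

Let max0 (x : V) : 0 < Num.max rho `|x|. Proof. by rewrite lt_max rho0. Qed.

Lemma radial_gain_gt0 (x : V) : 0 < radial_gain rho x.
Proof. by rewrite divr_gt0. Qed.

Lemma radial_id (x : V) : `|x| <= rho -> radial rho x = x.
Proof.
by move=> xr; rewrite /radial /radial_gain max_l// divff ?scale1r// gt_eqF.
Qed.

Lemma radial_norm (x : V) : `|radial rho x| <= rho.
Proof.
rewrite normrZ gtr0_norm ?radial_gain_gt0// mulrAC ler_pdivrMr// ler_pM2l//.
by rewrite le_max lexx orbT.
Qed.

Lemma radial_lipschitz (x y : V) :
  `|radial rho x - radial rho y| <= 2 * `|x - y|.
Proof.
have -> : radial rho x - radial rho y = radial_gain rho x *: (x - y)
    + (radial_gain rho x - radial_gain rho y) *: y.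
  by rewrite scalerBr scalerBl addrA subrK.
have gx : radial_gain rho x <= 1.
  by rewrite ler_pdivrMr// mul1r le_max lexx.
have h1 : `|radial_gain rho x *: (x - y)| <= `|x - y|.
  by rewrite normrZ gtr0_norm ?radial_gain_gt0// ler_piMl.
have maxB : `|Num.max rho `|y| - Num.max rho `|x| | <= `|x - y|.
  have := ler_dist_dist x y; rewrite ler_norml => /andP[? ?].
  rewrite ler_norml; apply/andP; split.
    by case: (leP rho `|x|) => ?; case: (leP rho `|y|) => ?; lra.
  by case: (leP rho `|x|) => ?; case: (leP rho `|y|) => ?; lra.
have h2 : `|(radial_gain rho x - radial_gain rho y) *: y| <= `|x - y|.
  have -> : radial_gain rho x - radial_gain rho y =
      radial_gain rho x * ((Num.max rho `|y| - Num.max rho `|x|) / Num.max rho `|y|).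
    by rewrite /radial_gain; field; rewrite !gt_eqF.
  rewrite normrZ normrM gtr0_norm ?radial_gain_gt0// -mulrA.
  rewrite (le_trans (ler_piMl _ gx))//.
  rewrite normrM normfV (gtr0_norm (max0 y)) mulrAC ler_pdivrMr//.
  by rewrite ler_pM// le_max lexx orbT.
by rewrite (le_trans (ler_normD _ _))// mulr_natl mulr2n lerD.
Qed.
End Radial.

(** The decay of the quadratic form holds on the whole domain, hence along every
    solution, which gives the exponential bound.
    Existence is obtained from the field precomposed with the radial
    retraction onto a small ball: it is globally Lipschitz, and it still
    decreases the form because the retraction only rescales [v - e] by a
    positive factor; a solution starting close to [e] thus never leaves the
    region where the field was not modified. *)
Lemma lyapunov_exp_stable d (F : 'cV[R]_d -> 'cV[R]_d) (D : set 'cV[R]_d)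
    (e : 'cV[R]_d) (X : 'M[R]_d) (lam rho k : R) :
  posdef X -> 0 < lam -> 0 < rho -> 0 < k ->
  (forall v, `|v - e| <= rho -> D v) ->
  (forall v w, `|v - e| <= rho -> `|w - e| <= rho -> `|F v - F w| <= k * `|v - w|) ->
  (forall v, D v -> 2 * dot (v - e) (X *m F v) <= - lam * quadform X (v - e)) ->
  locally_exp_stable F D e.
Proof.
move=> [Xs Xp] lam0 rho0 k0 ballD lip decF.
have [c1 c10 H1] := posdef_lower Xp.
have [c2 c20 Vle] := quadform_upper X.
have Xge v : 0 <= quadform X v.
  by rewrite (le_trans _ (H1 v))// mulr_ge0 ?dot_ge0 ?ltW.
(* The summand 1 keeps the constant positive in dimension 0. *)
pose c := Num.sqrt ((c2 * d%:R + 1) / c1).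
have c2d : 0 <= c2 * d%:R by rewrite mulr_ge0// ltW.
have cc0 : 0 < (c2 * d%:R + 1) / c1 by rewrite divr_gt0// ltr_wpDl.
have c0 : 0 < c by rewrite sqrtr_gt0.
have c_sq : c ^+ 2 = (c2 * d%:R + 1) / c1 by rewrite sqr_sqrtr ?ltW.
have norm_bound (b : R) (u w : 'cV[R]_d) : 0 <= b ->
    quadform X u <= b ^+ 2 * quadform X w -> `|u| <= c * b * `|w|.
  move=> b0 uw; rewrite -ler_sqr ?nnegrE ?normr_ge0 ?mulr_ge0 ?(ltW c0)//.
  apply: (le_trans (normr_dot u)); rewrite 2!exprMn c_sq.
  have h1 := H1 u; have h2 := Vle w; have h3 := dot_normr w.
  have h4 : quadform X w <= (c2 * d%:R + 1) * `|w| ^+ 2.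
    have : c2 * dot w w <= c2 * (d%:R * `|w| ^+ 2) by rewrite ler_pM2l.
    have := sqr_ge0 `|w|; lra.
  rewrite -(ler_pM2l c10); apply: (le_trans (le_trans h1 uw)).
  have -> : c1 * ((c2 * d%:R + 1) / c1 * b ^+ 2 * `|w| ^+ 2) =
      b ^+ 2 * ((c2 * d%:R + 1) * `|w| ^+ 2).
    by field; exact: lt0r_neq0.
  by rewrite ler_wpM2l// sqr_ge0.
have decay (T : \bar R) xi : ode_solution F D T xi ->
    forall t : R, 0 <= t -> (t%:E < T)%E ->
      `|xi t - e| <= c * expR (- (lam / 2) * t) * `|xi 0 - e|.
  move=> [cxi Dxi dxi] t t0 tT; apply: norm_bound; first exact: expR_ge0.
  rewrite expr2 -expRD.
  have -> : - (lam / 2) * t + - (lam / 2) * t = - lam * t by field.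
  have sT (s : R) : s <= t -> (s%:E < T)%E.
    by move=> st; apply: le_lt_trans tT; rewrite lee_fin.
  apply: (@quadform_decay d X (fun s => xi s - e) (fun s => F (xi s))) => //.
  - move=> s; apply: (@continuousB _ _ (subspace `[0, t]%classic) xi (cst e)).
      apply: continuous_subspaceW cxi s => s /=; rewrite in_itv/= => /andP[s0 st].
      by split=> //; exact: sT.
    exact: cst_continuous.
  - move=> s /andP[s0 st]; have h := is_derive_cst e s (1 : R).
    by have := is_deriveB (dxi s s0 (sT s (ltW st))) h; rewrite subr0.
  - by move=> s /andP[s0 st]; apply/decF/Dxi; [exact: ltW | exact/sT/ltW].
exists (rho / c), c, (lam / 2); split=> //; try exact: divr_gt0.
move=> v ve; split=> [|T xi sol <- t t0 tT]; last exact: (decay _ _ sol).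
pose G (w : 'cV[R]_d) := F (e + radial rho (w - e)).
have inball w : `|e + radial rho (w - e) - e| <= rho.
  by rewrite addrC addKr; exact: radial_norm.
have Glip x y : `|G x - G y| <= 2 * k * `|x - y|.
  apply: (le_trans (lip _ _ (inball x) (inball y))).
  rewrite [2 * k]mulrC -mulrA ler_pM2l// opprD addrACA subrr add0r.
  have -> : x - y = (x - e) - (y - e) by rewrite opprB addrA subrK.
  exact: radial_lipschitz.
have [|xi [cxi xi0 dxi]] := global_solution v _ Glip; first by rewrite mulr_gt0.
(* [F] at the retracted point decreases the form there; dividing by the positive
   gain of the retraction, it decreases the form at the original point. *)
have small (t : R) : 0 <= t -> `|xi t - e| <= rho.
  move=> t0; have : `|xi t - e| <= c * 1 * `|xi 0 - e|.
    apply: norm_bound => //; rewrite expr1n.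
    have -> : 1 = expR (- 0 * t) :> R by rewrite oppr0 mul0r expR0.
    apply: (@quadform_decay d X (fun s => xi s - e) (fun s => G (xi s))) => //.
    - apply: continuous_subspaceT => s; apply: (@continuousB _ _ _ xi (cst e)).
        exact: cxi.
      exact: cst_continuous.
    - move=> s /andP[s0 st]; have h := is_derive_cst e s (1 : R).
      by have := is_deriveB (dxi s s0) h; rewrite subr0.
    - move=> s _; rewrite oppr0 mul0r.
      have := decF _ (ballD _ (inball (xi s))).
      rewrite [e + _ - e]addrC addKr.
      rewrite {1}/radial dotZl mulrCA -/(G (xi s)) => h.
      have := Xge (radial rho (xi s - e)) => V0.
      have {}h := le_trans h (_ : - lam * quadform X (radial rho (xi s - e)) <= 0).
      rewrite -(pmulr_rle0 _ (radial_gain_gt0 rho0 (xi s - e))); apply: h.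
      by rewrite mulNr oppr_le0 mulr_ge0 ?(ltW lam0).
  rewrite mulr1 xi0 => /le_trans; apply.
  by move: ve; rewrite ltr_pdivlMr// mulrC => /ltW.
exists xi; split=> //; split.
- exact: continuous_subspaceT.
- by move=> t t0 _; exact/ballD/small.
- move=> t t0 _; have := dxi t t0.
  by rewrite /G radial_id ?small ?ltW// addrC subrK.
Qed.
End Lyapunov.

(** * The matrix inequality and its consequences *)

Section DualLMI.
Variable R : realType.

(** Restriction of the matrix inequality to the vectors whose last block, the one
    of the performance output, vanishes; the term of the exogenous signal is then
    a square which can be dropped. *)
Lemma lmi_dual N p nw s (a11 : 'M[R]_(N, N)) (a12 : 'M[R]_(N, p)) (a13 : 'M[R]_(N, s))
    (b1 : 'M[R]_(p, N)) (b2 : 'M[R]_(p, p)) (b3 : 'M[R]_(p, s))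
    (c1 : 'M[R]_(nw, N)) (c2 : 'M[R]_(nw, p)) (c3 : 'M[R]_(nw, s))
    (Th : 'M[R]_(p + p)) (gamma : R) :
  let M : 'M[R]_((N + N) + ((p + p) + (nw + s)), N + (p + s)) :=
    col_mx
      (col_mx (row_mx a11 (row_mx a12 a13)) (row_mx 1%:M (row_mx 0 0)))
      (col_mx
        (col_mx (row_mx b1 (row_mx b2 b3)) (row_mx 0 (row_mx 1%:M 0)))
        (col_mx (row_mx c1 (row_mx c2 c3)) (row_mx 0 (row_mx 0 1%:M)))) in
  let Pi :=
    bdiag (block_mx 0 (- 1%:M) (- 1%:M) 0 : 'M[R]_(N + N))
      (bdiag (- invmx Th)
        (bdiag (1%:M : 'M[R]_nw) (- (gamma ^+ 2)%:M : 'M[R]_s))) in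
  negdef (M^T *m Pi *m M) ->
  forall a b, (a != 0) || (b != 0) ->
    0 < 2 * dot (a11 *m a + a12 *m b) a
        + quadform (invmx Th) (col_mx (b1 *m a + b2 *m b) b).
Proof.
move=> M Pi [_ neg] a b ab.
have := neg (col_mx a (col_mx b 0)).
rewrite !col_mx_eq0 eqxx andbT negb_and => /(_ ab).
have -> : quadform (M^T *m Pi *m M) (col_mx a (col_mx b 0)) =
    quadform Pi (M *m col_mx a (col_mx b 0)).
  by rewrite !quadformE -!mulmxA [LHS]dot_mulmxr trmxK.
have -> : M *m col_mx a (col_mx b 0) =
    col_mx (col_mx (a11 *m a + a12 *m b) a)
      (col_mx (col_mx (b1 *m a + b2 *m b) b) (col_mx (c1 *m a + c2 *m b) 0)).
  rewrite /M !mul_col_mx !mul_row_col.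
  by rewrite !(mul1mx, mul0mx, mulmx0, addr0, add0r).
rewrite quadformE /Pi /bdiag !mul_block_col !(mul0mx, mulmx0, addr0, add0r).
rewrite !mulNmx !mul1mx !dot_col !dotNr -quadformE dot0l.
rewrite addr0 [dot a (_ + _)]dotC.
have := dot_ge0 (c1 *m a + c2 *m b); lra.
Qed.

(** The left member is a quadratic form in [(x, e, del)], whose restriction to
    [x = 0] is the negative form of the slow subsystem.  Here [x] is the
    deviation of the fast subsystem, and [SM] weighs the action of the slow
    motion [h] on it. *)
Lemma slow_fast_bound n N p (Pm BK : 'M[R]_N) (B1 : 'M[R]_(N, p)) (B3 : 'M[R]_(N, n))
    (CK : 'M[R]_(p, N)) (E3 : 'M[R]_(p, n)) (Th : 'M[R]_(p + p)) (SM : 'M[R]_(n, N)) :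
  (forall e del, (e != 0) || (del != 0) ->
    2 * dot e (Pm *m (BK *m e + B1 *m del)) + quadform Th (col_mx del (CK *m e)) < 0) ->
  exists kappa eps, [/\ 0 < kappa, 0 < eps & forall x e del,
    let h := BK *m e + B1 *m del + B3 *m x in
    2 * dot e (Pm *m h) + quadform Th (col_mx del (CK *m e + E3 *m x))
      + 2 * dot x (SM *m h) <= kappa * dot x x - eps * (dot e e + dot del del)].
Proof.
move=> primal.
pose Hm : 'M[R]_(N, n + (N + p)) := row_mx B3 (row_mx BK B1).
pose Ee : 'M[R]_(N, n + (N + p)) := row_mx 0 (row_mx 1%:M 0).
pose Ex : 'M[R]_(n, n + (N + p)) := row_mx 1%:M 0.
pose Sm : 'M[R]_(p + p, n + (N + p)) :=
  col_mx (row_mx 0 (row_mx 0 1%:M)) (row_mx E3 (row_mx CK 0)).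
pose X := 2 *: (Ee^T *m Pm *m Hm) + Sm^T *m Th *m Sm + 2 *: (Ex^T *m SM *m Hm).
have XE x e del : quadform X (col_mx x (col_mx e del)) =
    2 * dot e (Pm *m (BK *m e + B1 *m del + B3 *m x))
    + quadform Th (col_mx del (CK *m e + E3 *m x))
    + 2 * dot x (SM *m (BK *m e + B1 *m del + B3 *m x)).
  set v := col_mx x _.
  have HmE : Hm *m v = BK *m e + B1 *m del + B3 *m x.
    by rewrite /Hm /v !mul_row_col addrC.
  have EeE : Ee *m v = e by rewrite /Ee /v !mul_row_col !mul0mx mul1mx add0r addr0.
  have ExE : Ex *m v = x by rewrite /Ex /v !mul_row_col !mul0mx mul1mx addr0.
  have SmE : Sm *m v = col_mx del (CK *m e + E3 *m x).
    rewrite /Sm /v mul_col_mx !mul_row_col !mul0mx mul1mx !add0r addr0.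
    by rewrite [E3 *m x + _]addrC.
  rewrite quadformE /X !mulmxDl !dotDr -!scalemxAl !dotZr -!mulmxA HmE SmE.
  by rewrite quadformE ![dot v _]dot_mulmxr !trmxK EeE ExE SmE.
have [|kappa [eps [k0 e0 H]]] := @quadform_perturb R n (N + p) X.
  move=> y; rewrite -[y]vsubmxK; move: (usubmx y) (dsubmx y) => e del.
  rewrite col_mx_eq0 negb_and => /primal.
  by rewrite XE !mulmx0 !addr0 dot0l mulr0 addr0.
exists kappa, eps; split=> // x e del /=; rewrite -XE (le_trans (H _ _))//.
by rewrite dot_col.
Qed.

Lemma row_free_col_mx a b d (X : 'M[R]_(a, d)) (Y : 'M[R]_(b, d)) :
  row_free (col_mx X Y) -> row_free X /\ row_free Y.
Proof.
move=> /row_freeP[Z XYZ]; rewrite mul_col_mx scalar_mx_block in XYZ.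
move: XYZ; rewrite /block_mx => /eq_col_mx[XZ YZ]; split; apply/row_freeP.
  exists (lsubmx Z); move: XZ; rewrite -{1}[Z]hsubmxK mul_mx_row.
  by move=> /eq_row_mx[].
exists (rsubmx Z); move: YZ; rewrite -{1}[Z]hsubmxK mul_mx_row.
by move=> /eq_row_mx[].
Qed.

(** Dimension count.  The null space of [Nm] is the range of [Tu]; as [Nm] and
    [Tu^T] have independent rows, [q = m - nc].  The matrix [K] is thus square,
    and it is injective. *)
Lemma gain_surjective m q nc (K : 'M[R]_(m, q + nc)) (Tu : 'M[R]_(m, q))
    (Hs : 'M[R]_m) (Nm : 'M[R]_(nc, m)) :
  (forall u : 'cV[R]_m, (exists y : 'cV[R]_q, u = Tu *m y) <-> Nm *m u = 0) ->
  (forall e : 'cV[R]_(q + nc), e != 0 -> col_mx (Tu^T *m Hs) Nm *m (K *m e) != 0) ->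
  forall u : 'cV[R]_m, exists eta, K *m eta = u.
Proof.
move=> TuN inj u.
have BKu : col_mx (Tu^T *m Hs) Nm *m K \in unitmx.
  apply: injmx_unit => e; rewrite -mulmxA => e0; apply/eqP.
  by apply: contraT => /inj; rewrite e0 eqxx.
have /row_free_col_mx[fT fN] : row_free (col_mx (Tu^T *m Hs) Nm).
  apply/row_freeP; exists (K *m invmx (col_mx (Tu^T *m Hs) Nm *m K)).
  by rewrite mulmxA mulmxV.
have {}fT : row_free Tu^T.
  by move/row_freeP: fT => [Z TZ]; apply/row_freeP; exists (Hs *m Z); rewrite mulmxA.
have eqT : (Tu^T :=: kermx Nm^T)%MS.
  apply/eqmxP/andP; split.
    apply/sub_kermxP; rewrite -trmx_mul.
    have -> : Nm *m Tu = 0; last by rewrite trmx0.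
    apply/matrixP => i j; have : Nm *m (Tu *m (delta_mx j 0 : 'cV[R]_q)) = 0.
      by apply/TuN; exists (delta_mx j 0).
    by rewrite mulmxA -colE => /matrixP/(_ i 0); rewrite !mxE.
  apply/row_subP => i.
  have Nr : Nm *m (row i (kermx Nm^T))^T = 0.
    by apply: trmx_inj; rewrite trmx_mul trmxK trmx0 -row_mul mulmx_ker row0.
  have [y rE] := (TuN _).2 Nr.
  by rewrite -[row _ _]trmxK rE trmx_mul submxMl.
have qm : (q + nc)%N = m.
  have rT : \rank Tu^T = q by apply/eqP.
  have rN : \rank Nm = nc by apply/eqP.
  have := rT; rewrite eqT mxrank_ker mxrank_tr rN => qE.
  by rewrite -qE subnK// -rN rank_leq_col.
have fK : row_free K.
  have rk : \rank (col_mx (Tu^T *m Hs) Nm *m K) = (q + nc)%N.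
    by apply/eqP; move: BKu; rewrite -row_free_unit.
  have := mxrankM_maxr (col_mx (Tu^T *m Hs) Nm) K; rewrite rk => h.
  rewrite /row_free eqn_leq rank_leq_row /=; apply: leq_trans h.
  by rewrite qm.
by move/row_freeP: fK => [Z KZ]; exists (Z *m u); rewrite mulmxA KZ mul1mx.
Qed.

Lemma multiplier_gain m r q (Tu : 'M[R]_(m, q)) (G : 'M[R]_(r, m))
    (Q1 : 'M[R]_m) (Q2 : 'M[R]_r) (g1 g2 : R) (v : 'cV[R]_m) :
  - ((Tu^T *m Q1 + (G *m Tu)^T *m Q2 *m G) *m v)
    + (- Tu^T *m (g1 *: v) + - (G *m Tu)^T *m (g2 *: (G *m v))) =
  - (Tu^T *m (Q1 + g1%:M + G^T *m (Q2 + g2%:M) *m G) *m v).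
Proof.
rewrite trmx_mul !mulNmx !(mulmxDl, mulmxDr) !(mul_scalar_mx, mul_mx_scalar).
rewrite -?scalemxAl -?scalemxAr ?mulmxA -?scalemxAl ?mulmxA.
by apply/matrixP => i j; rewrite !mxE; ring.
Qed.
End DualLMI.

(** * Interior optima of convex costs *)

Section Costs.
Variable R : realType.

Lemma cost_grad_local_lipschitz d (U : set 'cV[R]_d) f x :
  convex_cost U f -> U° x -> exists r k, [/\ 0 < r, 0 < k &
    forall y z, `|y - x| < r -> `|z - x| < r ->
      [/\ U° y, U° z & `|grad (fine \o f) y - grad (fine \o f) z| <= k * `|y - z|]].
Proof.
move=> cf Ux; have lip := cost_grad_lip cf.
have /lip : (U° `*` U°) (x, x) by [].
move=> [M [Mreal HM]].
pose k := Num.max M 0 + 1.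
have k0 : 0 < k by rewrite ltr_wpDl// le_max lexx orbT.
have kM : M < k by rewrite ltr_pwDr// le_max lexx.
have [[B1 B2] /= [/nbhs_ballP[r1 /= r10 H1] /nbhs_ballP[r2 /= r20 H2]] H] := HM k kM.
have /nbhs_ballP[r3 /= r30 H3] : nbhs x U° by exact: nbhs_interior.
exists (Num.min r1 (Num.min r2 r3)), k; split=> //; first by rewrite !lt_min r10 r20.
move=> y z; rewrite !lt_min => /and3P[y1 y2 y3] /and3P[z1 z2 z3].
have Uy : U° y by apply: H3; rewrite -ball_normE /= distrC.
have Uz : U° z by apply: H3; rewrite -ball_normE /= distrC.
split=> //; apply: (H (y, z)); last by split.
by split=> /=; [apply: H1 | apply: H2]; rewrite -ball_normE /= distrC.
Qed.

Lemma interior_direction d (U : set 'cV[R]_d) x v : U° x ->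
  exists2 s : R, 0 < s & forall t : R, 0 <= t <= s -> U° (x + t *: v).
Proof.
move=> Ux; have /nbhs_ballP[r /= r0 H] : nbhs x U° by exact: nbhs_interior.
have v0 : 0 < `|v| + 1 by rewrite ltr_wpDl.
exists (r / (2 * (`|v| + 1))) => [|t /andP[t0 ts]]; first by rewrite divr_gt0// mulr_gt0.
apply: H; rewrite -ball_normE /= opprD addNKr normrN normrZ ger0_norm//.
apply: (@le_lt_trans _ _ (r / (2 * (`|v| + 1)) * (`|v| + 1))).
  by rewrite ler_pM// lerDl.
have -> : r / (2 * (`|v| + 1)) * (`|v| + 1) = r / 2.
  by field; exact: lt0r_neq0.
by rewrite ltr_pdivrMr// ltr_pMr// ltr1n.
Qed.

(** First-order optimality: along a feasible direction the directional
    derivative of the cost at an interior optimum is nonnegative, and the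
    opposite of a direction [(Tz y, Tu y)] is again of this form. *)
Lemma optimal_stationary n m r nw nc q (P : plant R n m r nw)
    (pb : steady_problem R m r nw nc) w z u
    (Tz : 'M[R]_(r, q)) (Tu : 'M[R]_(m, q)) :
  convex_cost (domU pb) (cost_f pb) -> convex_cost (domZ pb) (cost_g pb) ->
  optimal P pb w z u -> (domU pb)° u -> (domZ pb)° z ->
  (forall y : 'cV[R]_q, Tz *m y = dcgain_u P *m (Tu *m y) /\
    conHz pb *m (Tz *m y) + conHu pb *m (Tu *m y) = 0) ->
  Tu^T *m grad (fine \o cost_f pb) u + Tz^T *m grad (fine \o cost_g pb) z = 0.
Proof.
move=> cf cg [[_ _ zE conE] opt] Uu Zz dirs.
set f := fine \o cost_f pb; set g := fine \o cost_g pb.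
set p := _ + _.
suff key (y : 'cV[R]_q) : 0 <= dot p y.
  apply/eqP; rewrite -dot_eq0; apply/eqP/le_anti; rewrite dot_ge0 andbT.
  by have := key (- p); rewrite dotNr oppr_ge0.
have [s1 s10 H1] := interior_direction (Tu *m y) Uu.
have [s2 s20 H2] := interior_direction (Tz *m y) Zz.
pose s := Num.min s1 s2; have s0 : 0 < s by rewrite lt_min s10.
pose du := s *: (Tu *m y); pose dz := s *: (Tz *m y).
have ts t : 0 <= t <= 1 -> 0 <= t * s <= s.
  by move=> /andP[t0 t1]; rewrite mulr_ge0 ?(ltW s0)//= ler_piMl// ltW.
have Ut t : 0 <= t <= 1 -> (domU pb)° (u + t *: du).
  move=> /ts /andP[a b]; rewrite /du scalerA; apply: H1.
  by rewrite a (le_trans b)// ge_min lexx.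
have Zt t : 0 <= t <= 1 -> (domZ pb)° (z + t *: dz).
  move=> /ts /andP[a b]; rewrite /dz scalerA; apply: H2.
  by rewrite a (le_trans b)// ge_min lexx orbT.
pose phi (t : R) := - (f (u + t *: du) + g (z + t *: dz)).
have z01 : 0 <= (0 : R) <= 1 by rewrite lexx ler01.
have dphi : is_derive (0 : R) (1 : R) phi (- (dot (grad f u) du + dot (grad g z) dz)).
  have h1 : is_derive (0 : R) (1 : R) (fun t => f (u + t *: du)) (dot (grad f u) du).
    have := @is_derive_segment R m f u du 0; rewrite scale0r addr0; apply.
    exact: (cost_diff cf).
  have h2 : is_derive (0 : R) (1 : R) (fun t => g (z + t *: dz)) (dot (grad g z) dz).
    have := @is_derive_segment R r g z dz 0; rewrite scale0r addr0; apply.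
    exact: (cost_diff cg).
  exact: (is_deriveN (is_deriveD h1 h2)).
have := is_derive_max0 dphi; rewrite oppr_le0.
have -> : dot (grad f u) du + dot (grad g z) dz = s * dot p y.
  rewrite /du /dz !dotZr !dot_mulmxr -mulrDr /p dotDl //.
rewrite pmulr_rge0//; apply => t t01.
rewrite /phi lerN2 !scale0r !addr0.
have feas : feasible P pb w (z + t *: dz) (u + t *: du).
  have [d1 d2] := dirs y.
  split.
  - by apply: interior_subset; exact: Ut.
  - by apply: interior_subset; exact: Zt.
  - by rewrite /dz /du d1 zE mulmxDr -!scalemxAr addrAC.
  rewrite conE /con_error !mulmxDr /dz /du.
  have e0 : conHz pb *m (t *: (s *: (Tz *m y))) + conHu pb *m (t *: (s *: (Tu *m y))) = 0.
    by rewrite -!scalemxAr -!scalerDr d2 !scaler0.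
  by rewrite addrACA e0 addr0.
have := opt _ _ feas.
have fin_f v : (domU pb)° v -> cost_f pb v = (f v)%:E.
  by move=> Uv; rewrite /f /= fineK//; exact: (cost_fin cf).
have fin_g v : (domZ pb)° v -> cost_g pb v = (g v)%:E.
  by move=> Zv; rewrite /g /= fineK//; exact: (cost_fin cg).
by rewrite (fin_f _ Uu) (fin_g _ Zz) (fin_f _ (Ut _ t01)) (fin_g _ (Zt _ t01)) lee_fin.
Qed.
End Costs.

(** * The closed loop *)

Section ClosedLoop.
Variables (R : realType) (n m r nw nc q : nat).
Variables (A : 'M[R]_n) (B : 'M[R]_(n, m)) (Bw : 'M[R]_(n, nw)).
Variables (C : 'M[R]_(r, n)) (D : 'M[R]_(r, m)) (Dw : 'M[R]_(r, nw)).
Variables (U : set 'cV[R]_m) (f0 : 'cV[R]_m -> \bar R).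
Variables (Zs : set 'cV[R]_r) (g0 : 'cV[R]_r -> \bar R).
Variables (Hz : 'M[R]_(nc, r)) (Hu : 'M[R]_(nc, m)) (Hw : 'M[R]_(nc, nw)).
Variables (Tz : 'M[R]_(r, q)) (Tu : 'M[R]_(m, q)) (K : 'M[R]_(m, q + nc)).
Variable tau : R.

Local Notation P := (Plant A B Bw C D Dw).
Local Notation pb := (SteadyProblem U f0 Zs g0 Hz Hu Hw).
Local Notation Gu := (dcgain_u P).
Local Notation Gw := (dcgain_w P).
Local Notation ctrl := (gradient_controller pb Tz Tu (lsubmx K) (rsubmx K) tau).
Local Notation df := (grad (fine \o f0)).
Local Notation dg := (grad (fine \o g0)).

Hypothesis A_unit : A \in unitmx.

Definition deviation (w : 'cV[R]_nw) (xi : 'cV[R]_(n + (q + nc))) : 'cV[R]_n :=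
  usubmx xi + invmx A *m (B *m (K *m dsubmx xi) + Bw *m w).

Definition reduced_field (w : 'cV[R]_nw) (z : 'cV[R]_r) (u : 'cV[R]_m) : 'cV[R]_(q + nc) :=
  col_mx (- (Tu^T *m df u) - Tz^T *m dg z) (- con_error pb w z u).

Lemma cl_inputE (xi : 'cV[R]_(n + (q + nc))) : cl_input ctrl xi = K *m dsubmx xi.
Proof. by rewrite /cl_input /= -mul_row_col hsubmxK vsubmxK. Qed.

Lemma cl_domE w (xi : 'cV[R]_(n + (q + nc))) : cl_dom P ctrl w xi =
  (U° (K *m dsubmx xi) /\ Zs° (cl_output P ctrl w xi)).
Proof. by rewrite -cl_inputE. Qed.

Lemma cl_outputE w (xi : 'cV[R]_(n + (q + nc))) : cl_output P ctrl w xi =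
  Gu *m (K *m dsubmx xi) + Gw *m w + C *m deviation w xi.
Proof.
rewrite /cl_output cl_inputE /= /deviation /dcgain_u /dcgain_w /=.
move: (K *m dsubmx xi) => u; rewrite !mulmxDr !mulmxDl !mulNmx !mulmxA.
by apply/matrixP => i j; rewrite !mxE; ring.
Qed.

Lemma cl_fieldE w (xi : 'cV[R]_(n + (q + nc))) : cl_field P pb ctrl w xi =
  col_mx (A *m deviation w xi)
    (tau^-1 *: reduced_field w (cl_output P ctrl w xi) (K *m dsubmx xi)).
Proof.
rewrite /cl_field cl_inputE /= /reduced_field; congr col_mx.
by rewrite /deviation mulmxDr mulKVmx// addrA.
Qed.

Variables (Q1 : 'M[R]_m) (ft : 'cV[R]_m -> R) (Q2 : 'M[R]_r) (gt : 'cV[R]_r -> R).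
Hypothesis split_f : cost_splitting U f0 Q1 ft.
Hypothesis split_g : cost_splitting Zs g0 Q2 gt.

Definition residual (z z' : 'cV[R]_r) (u u' : 'cV[R]_m) : 'cV[R]_(m + r) :=
  col_mx (grad ft u - grad ft u') (grad gt z - grad gt z').

Local Notation cB := (col_mx (- (Tu^T *m Q1 + Tz^T *m Q2 *m Gu)) (- (Hz *m Gu + Hu))).
Local Notation cB1 := (block_mx (- Tu^T) (- Tz^T) 0 0 : 'M[R]_(q + nc, m + r)).
Local Notation cB3 := (col_mx (- (Tz^T *m Q2 *m C)) (- (Hz *m C))).
Local Notation cE1 := (col_mx 1%:M Gu).
Local Notation cE3 := (col_mx 0 C : 'M[R]_(m + r, n)).

Lemma reduced_field_diff w z z' u u' x :
  U° u -> U° u' -> Zs° z -> Zs° z' -> z - z' = Gu *m (u - u') + C *m x ->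
  reduced_field w z u - reduced_field w z' u' =
  cB *m (u - u') + cB1 *m residual z z' u u' + cB3 *m x.
Proof.
move=> Uu Uu' Zz Zz' zE.
rewrite /reduced_field /residual (split_grad split_f Uu) (split_grad split_f Uu').
rewrite (split_grad split_g Zz) (split_grad split_g Zz').
rewrite mul_block_col !mul_col_mx !mul0mx addr0 opp_col_mx !add_col_mx.
move: (grad ft u) (grad ft u') (grad gt z) (grad gt z') zE => a a' b b'.
move: (dcgain_u P) => G zE.
congr col_mx.
  have -> : - (Tu^T *m (Q1 *m u + a)) - Tz^T *m (Q2 *m z + b)
    - (- (Tu^T *m (Q1 *m u' + a')) - Tz^T *m (Q2 *m z' + b')) =
    - (Tu^T *m (Q1 *m (u - u'))) - Tz^T *m (Q2 *m (z - z'))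
    - Tu^T *m (a - a') - Tz^T *m (b - b').
    by rewrite !mulmxDr !mulmxN; apply/matrixP => i j; rewrite !mxE; ring.
  rewrite zE !mulNmx !mulmxDl !mulmxDr !mulmxN !mulmxA.
  by apply/matrixP => i j; rewrite !mxE; ring.
rewrite addr0 /con_error /=.
have -> : - (Hz *m z + Hu *m u + Hw *m w) - - (Hz *m z' + Hu *m u' + Hw *m w) =
   - (Hz *m (z - z') + Hu *m (u - u')).
  by rewrite !mulmxDr !mulmxN; apply/matrixP => i j; rewrite !mxE; ring.
rewrite zE !mulNmx !mulmxDl !mulmxDr !mulmxN !mulmxA.
by apply/matrixP => i j; rewrite !mxE; ring.
Qed.

Variables (Theta : 'M[R]_((m + r) + (m + r))) (Pm : 'M[R]_(q + nc)).
Hypothesis primal : forall e del, (e != 0) || (del != 0) ->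
  2 * dot e (Pm *m (cB *m K *m e + cB1 *m del))
    + quadform Theta (col_mx del (cE1 *m K *m e)) < 0.
Hypothesis sector : forall u u' z z', U° u -> U° u' -> Zs° z -> Zs° z' ->
  0 <= quadform Theta (col_mx (residual z z' u u') (col_mx (u - u') (z - z'))).

Lemma cl_output_diff w (xi xi' : 'cV[R]_(n + (q + nc))) :
  cl_output P ctrl w xi - cl_output P ctrl w xi' =
  Gu *m (K *m dsubmx xi - K *m dsubmx xi') + C *m (deviation w xi - deviation w xi').
Proof.
rewrite !cl_outputE !mulmxBr.
by apply/matrixP => i j; rewrite !mxE; ring.
Qed.

Lemma sector_input_output w (xi xi' : 'cV[R]_(n + (q + nc))) :
  col_mx (K *m dsubmx xi - K *m dsubmx xi')
         (cl_output P ctrl w xi - cl_output P ctrl w xi') =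
  cE1 *m K *m (dsubmx xi - dsubmx xi') + cE3 *m (deviation w xi - deviation w xi').
Proof.
rewrite cl_output_diff -!mulmxBr -mulmxA !mul_col_mx mul1mx mul0mx add_col_mx addr0.
by [].
Qed.

(** The difference of two equilibria is a state [e] of the reduced system for
    which the left member of the strict inequality is a value of the sector
    form, hence nonnegative. *)
Lemma equilibrium_unique w xi xi' : tau != 0 ->
  equilibrium (cl_field P pb ctrl w) (cl_dom P ctrl w) xi ->
  equilibrium (cl_field P pb ctrl w) (cl_dom P ctrl w) xi' -> xi' = xi.
Proof.
move=> tau0 [Dxi Fxi] [Dxi' Fxi'].
have split_eq y : cl_field P pb ctrl w y = 0 -> deviation w y = 0 /\
    reduced_field w (cl_output P ctrl w y) (K *m dsubmx y) = 0.
  rewrite cl_fieldE -[X in _ = X]col_mx0 => /eq_col_mx[h1 /eqP h2]; split.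
    by rewrite -[deviation w y](mulKmx A_unit) h1 mulmx0.
  by move: h2; rewrite scaler_eq0 invr_eq0 (negPf tau0) /= => /eqP.
have [d1 r1] := split_eq _ Fxi; have [d2 r2] := split_eq _ Fxi'.
move: Dxi Dxi'; rewrite !cl_domE => -[Uu Zz] [Uu' Zz'].
have := reduced_field_diff w Uu' Uu Zz' Zz (cl_output_diff w xi' xi).
rewrite r1 r2 d1 d2 !subrr mulmx0 addr0 -mulmxBr mulmxA => /esym h.
have := sector Uu' Uu Zz' Zz; rewrite sector_input_output d1 d2 subrr mulmx0 addr0.
move: (residual _ _ _ _) h => del h sec.
have de : dsubmx xi' - dsubmx xi = 0.
  apply/eqP; apply: contraT => e0.
  have := @primal (dsubmx xi' - dsubmx xi) del; rewrite e0 => /(_ isT).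
  by rewrite h mulmx0 dot0r mulr0 add0r ltNge sec.
have dd : dsubmx xi' = dsubmx xi by apply/eqP; rewrite -subr_eq0 de.
have uu : usubmx xi' = usubmx xi.
  by apply: (addIr (invmx A *m (B *m (K *m dsubmx xi) + Bw *m w)));
    rewrite -{1}dd; move: d1 d2; rewrite /deviation => -> ->.
by rewrite -[xi']vsubmxK -[xi]vsubmxK uu dd.
Qed.

Lemma mulmx_lipschitz a b (M : 'M[R]_(a, b)) :
  exists2 c, 0 < c & forall v : 'cV[R]_b, `|M *m v| <= c * `|v|.
Proof.
have [c c0 H] := mulmx_bound M.
have cb : 0 < c * b%:R + 1 by rewrite ltr_wpDl// mulr_ge0// ltW.
exists (Num.sqrt (c * b%:R + 1)) => [|v]; first by rewrite sqrtr_gt0.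
rewrite -ler_sqr ?nnegrE ?normr_ge0 ?mulr_ge0 ?sqrtr_ge0//.
apply: (le_trans (normr_dot _)); apply: (le_trans (H v)).
rewrite exprMn sqr_sqrtr ?(ltW cb)//.
have : c * dot v v <= c * (b%:R * `|v| ^+ 2) by rewrite ler_pM2l// dot_normr.
have := sqr_ge0 `|v|; lra.
Qed.

(** Increments of the field are linear in the increments of the state and of the
    two gradients, and the gradients are locally Lipschitz. *)
Lemma cl_local_lipschitz w xi :
  convex_cost U f0 -> convex_cost Zs g0 -> cl_dom P ctrl w xi ->
  exists rho k, [/\ 0 < rho, 0 < k,
    forall v, `|v - xi| <= rho -> cl_dom P ctrl w v &
    forall v v', `|v - xi| <= rho -> `|v' - xi| <= rho ->
      `|cl_field P pb ctrl w v - cl_field P pb ctrl w v'| <= k * `|v - v'|].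
Proof.
move=> cf cg; rewrite /cl_dom /= => -[Uu Zz].
have [rf [kf [rf0 kf0 Hf]]] := cost_grad_local_lipschitz cf Uu.
have [rg [kg [rg0 kg0 Hg]]] := cost_grad_local_lipschitz cg Zz.
pose Mu : 'M[R]_(m, n + (q + nc)) := row_mx 0 K.
pose Mz : 'M[R]_(r, n + (q + nc)) := row_mx C (D *m K).
have uE v v' : cl_input ctrl v - cl_input ctrl v' = Mu *m (v - v').
  by rewrite !cl_inputE -[v in RHS]vsubmxK -[v' in RHS]vsubmxK opp_col_mx
     add_col_mx /Mu mul_row_col mul0mx add0r mulmxBr.
have zE v v' : cl_output P ctrl w v - cl_output P ctrl w v' = Mz *m (v - v').
  rewrite /cl_output !cl_inputE -[v in RHS]vsubmxK -[v' in RHS]vsubmxK opp_col_mx add_col_mx.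
  rewrite /Mz mul_row_col !mulmxBr !mulmxA /=.
  by apply/matrixP => i j; rewrite !mxE; ring.
have [cu cu0 Hu'] := mulmx_lipschitz Mu; have [cz cz0 Hz'] := mulmx_lipschitz Mz.
pose M1 : 'M[R]_(n + (q + nc)) :=
  col_mx (row_mx A (B *m K)) (tau^-1 *: col_mx 0 (- (Hz *m Mz + Hu *m Mu))).
pose M2 : 'M[R]_(n + (q + nc), m) := col_mx 0 (tau^-1 *: col_mx (- Tu^T) 0).
pose M3 : 'M[R]_(n + (q + nc), r) := col_mx 0 (tau^-1 *: col_mx (- Tz^T) 0).
have FE v v' : cl_field P pb ctrl w v - cl_field P pb ctrl w v' = M1 *m (v - v')
    + M2 *m (df (cl_input ctrl v) - df (cl_input ctrl v'))
    + M3 *m (dg (cl_output P ctrl w v) - dg (cl_output P ctrl w v')).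
  rewrite /M1 /M2 /M3 !mul_col_mx -!scalemxAl !mul_col_mx !mul0mx !mulNmx mulmxDl.
  rewrite -!(mulmxA _ _ (v - v')) -uE -zE opp_col_mx !add_col_mx !addr0.
  congr col_mx.
    rewrite !cl_inputE /= -[v in RHS]vsubmxK -[v' in RHS]vsubmxK.
    rewrite opp_col_mx add_col_mx mul_row_col !mulmxBr !mulmxA.
    by apply/matrixP => i j; rewrite !mxE; ring.
  move: (cl_input ctrl v) (cl_input ctrl v') => u u'.
  move: (cl_output P ctrl w v) (cl_output P ctrl w v') => z z' /=.
  rewrite -!scalerBr -!scalerDr; congr (_ *: _); rewrite opp_col_mx !add_col_mx.
  congr col_mx.
    by rewrite !mulmxBr; apply/matrixP => i j; rewrite !mxE; ring.
  rewrite !addr0 /con_error /= !mulmxBr.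
  by apply/matrixP => i j; rewrite !mxE; ring.
have [c1 c10 H1] := mulmx_lipschitz M1.
have [c2 c20 H2] := mulmx_lipschitz M2.
have [c3 c30 H3] := mulmx_lipschitz M3.
pose rho := Num.min (rf / (2 * cu)) (rg / (2 * cz)).
have near_u v : `|v - xi| <= rho -> `|cl_input ctrl v - cl_input ctrl xi| < rf.
  rewrite le_min => /andP[+ _]; rewrite ler_pdivlMr ?mulr_gt0// => h.
  have := Hu' (v - xi); rewrite uE; nra.
have near_z v : `|v - xi| <= rho -> `|cl_output P ctrl w v - cl_output P ctrl w xi| < rg.
  rewrite le_min => /andP[_]; rewrite ler_pdivlMr ?mulr_gt0// => h.
  have := Hz' (v - xi); rewrite zE; nra.
exists rho, (c1 + c2 * (kf * cu) + c3 * (kg * cz)); split.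
- by rewrite lt_min !divr_gt0 ?mulr_gt0.
- by rewrite !addr_gt0 ?mulr_gt0.
- move=> v vr; have [uu _ _] := Hf _ _ (near_u _ vr) (near_u _ vr).
  by have [zz _ _] := Hg _ _ (near_z _ vr) (near_z _ vr); split.
- move=> v v' vr vr'.
  have [_ _ hf] := Hf _ _ (near_u _ vr) (near_u _ vr').
  have [_ _ hg] := Hg _ _ (near_z _ vr) (near_z _ vr').
  rewrite FE !mulrDl; apply: (le_trans (ler_normD _ _)); apply: lerD.
    apply: (le_trans (ler_normD _ _)); apply: lerD; first exact: H1.
    apply: (le_trans (H2 _)); rewrite -mulrA ler_pM2l//.
    apply: (le_trans hf); rewrite -mulrA ler_pM2l//.
    by rewrite uE; exact: Hu'.
  apply: (le_trans (H3 _)); rewrite -mulrA ler_pM2l//.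
  apply: (le_trans hg); rewrite -mulrA ler_pM2l//.
  by rewrite zE; exact: Hz'.
Qed.

(** The plant equilibrium [x = - A^-1 (B u + Bw w)] associated with an optimal
    input reproduces the optimal output, and stationarity of the cost together
    with feasibility are the two blocks of the controller equation. *)
Lemma loop_equilibrium w z u eta :
  U° u -> Zs° z -> z = Gu *m u + Gw *m w -> con_error pb w z u = 0 ->
  Tu^T *m df u + Tz^T *m dg z = 0 -> K *m eta = u ->
  let xi := col_mx (- (invmx A *m (B *m u + Bw *m w))) eta in
  [/\ equilibrium (cl_field P pb ctrl w) (cl_dom P ctrl w) xi,
      cl_output P ctrl w xi = z & cl_input ctrl xi = u].
Proof.
move=> Uu Zz zE conE stat etaE xi.
have dxi : deviation w xi = 0.
  by rewrite /deviation /xi col_mxKu col_mxKd etaE addNr.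
have zxi : cl_output P ctrl w xi = z.
  by rewrite cl_outputE dxi mulmx0 addr0 /xi col_mxKd etaE zE.
have uxi : cl_input ctrl xi = u by rewrite cl_inputE /xi col_mxKd etaE.
split=> //; split; first by rewrite cl_domE zxi -cl_inputE uxi.
rewrite cl_fieldE dxi mulmx0 zxi -cl_inputE uxi /reduced_field conE oppr0.
by rewrite -opprD stat oppr0 col_mx0 scaler0 col_mx0.
Qed.

(** Composite Lyapunov function: the form [S] of the plant in the deviation
    from its quasi-steady state plus the form [Pm] of the reduced loop in the
    controller state.  The slow derivative is [O(1/tau)], so the coupling is
    absorbed by the decay of the fast part for [tau] large. *)
Lemma loop_stable w xi (S : 'M[R]_n) kappa eps :
  convex_cost U f0 -> convex_cost Zs g0 ->
  posdef S -> (forall x, 2 * dot x (S *m (A *m x)) <= - dot x x) -> posdef Pm ->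
  0 < kappa -> 0 < eps ->
  (forall x e del, let h := cB *m K *m e + cB1 *m del + cB3 *m x in
    2 * dot e (Pm *m h) + quadform Theta (col_mx del (cE1 *m K *m e + cE3 *m x))
      + 2 * dot x (S *m (invmx A *m B *m K) *m h)
    <= kappa * dot x x - eps * (dot e e + dot del del)) ->
  2 * kappa < tau ->
  equilibrium (cl_field P pb ctrl w) (cl_dom P ctrl w) xi ->
  locally_exp_stable (cl_field P pb ctrl w) (cl_dom P ctrl w) xi.
Proof.
move=> cf cg [Ss Sp] lyap [Ps Pp] kappa0 eps0 bound tauk [Dxi Fxi].
have tau0 : 0 < tau by apply: lt_trans tauk; rewrite mulr_gt0.
pose Mx := invmx A *m B *m K.
pose L : 'M[R]_(n + (q + nc)) := block_mx 1%:M Mx 0 1%:M.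
pose X := L^T *m bdiag S Pm *m L.
have LE a b : L *m col_mx a b = col_mx (a + Mx *m b) b.
  by rewrite /L mul_block_col !mul1mx mul0mx add0r.
have XE v v' : dot v (X *m v') = dot (L *m v) (bdiag S Pm *m (L *m v')).
  by rewrite /X -!mulmxA dot_mulmxr trmxK.
have bE a b a' b' : dot (col_mx a b) (bdiag S Pm *m col_mx a' b') =
    dot a (S *m a') + dot b (Pm *m b').
  by rewrite /bdiag mul_block_col !mul0mx addr0 add0r dot_col.
have bT : (bdiag S Pm)^T = bdiag S Pm by rewrite /bdiag tr_block_mx !trmx0 Ss Ps.
have Xpos : posdef X.
  split; first by rewrite /X !trmx_mul trmxK bT mulmxA.
  move=> v; rewrite -[v]vsubmxK; move: (usubmx v) (dsubmx v) => a b v0.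
  rewrite quadformE XE LE bE -!quadformE.
  have Sge x : 0 <= quadform S x.
    by have [->|/Sp/ltW//] := eqVneq x 0; rewrite quadformE dot0l.
  have [b0|/Pp b0] := eqVneq b 0; last by rewrite ltr_wpDl.
  move: v0; rewrite b0 col_mx_eq0 eqxx andbT mulmx0 addr0 => /Sp.
  by rewrite quadformE [quadform Pm 0]quadformE dot0l addr0.
have [s s0 Hs] := quadform_upper S; have [p p0 Hp] := quadform_upper Pm.
have [rho [k [rho0 k0 ball lip]]] := cl_local_lipschitz cf cg Dxi.
(* Half of the decay of the plant and the decay [eps / tau] of the controller
   state, relative to the bounds [s] and [p] of the two forms. *)
pose lam := Num.min (2 * s)^-1 (eps / tau / p).
have lam0 : 0 < lam by rewrite lt_min invr_gt0 !divr_gt0 ?mulr_gt0.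
apply: (lyapunov_exp_stable Xpos lam0 rho0 k0 ball lip) => v Dv.
have dxi : deviation w xi = 0.
  move: Fxi; rewrite cl_fieldE -[X in _ = X]col_mx0 => /eq_col_mx[h1 _].
  by rewrite -[deviation w xi](mulKmx A_unit) h1 mulmx0.
have rxi : reduced_field w (cl_output P ctrl w xi) (K *m dsubmx xi) = 0.
  move: Fxi; rewrite cl_fieldE -[X in _ = X]col_mx0 => /eq_col_mx[_ /eqP].
  by rewrite scaler_eq0 invr_eq0 gt_eqF//= => /eqP.
move: Dxi Dv; rewrite !cl_domE => -[Uu Zz] [Uv Zv].
set x := deviation w v; set e := dsubmx v - dsubmx xi.
have Lv : L *m (v - xi) = col_mx x e.
  rewrite -[v - xi]vsubmxK LE !linearB /= -/e; congr col_mx.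
  rewrite -[x]subr0 -dxi /x /deviation /Mx !mulmxDr !mulmxA.
  by apply/matrixP => i j; rewrite !mxE; ring.
have := reduced_field_diff w Uv Uu Zv Zz (cl_output_diff w v xi).
have := sector Uv Uu Zv Zz; rewrite sector_input_output dxi !subr0 -/e -/x.
rewrite rxi subr0 -mulmxBr mulmxA -/e; move: (residual _ _ _ _) => del sec hE.
have Fv : cl_field P pb ctrl w v = col_mx (A *m x)
    (tau^-1 *: (cB *m K *m e + cB1 *m del + cB3 *m x)) by rewrite cl_fieldE hE.
have {hE} := bound x e del.
have -> : quadform X (v - xi) = quadform S x + quadform Pm e.
  by rewrite quadformE XE Lv bE -!quadformE.
rewrite XE Lv Fv LE bE /=; clearbody x e.
move: (cB *m K *m e + _ + _) => h; rewrite -!scalemxAr mulmxDr !dotDr -!scalemxAr !dotZr.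
rewrite -/Mx -!(mulmxA S) => bnd.
have ls : lam * quadform S x <= dot x x / 2.
  apply: (@le_trans _ _ (lam * (s * dot x x))); first by rewrite ler_pM2l.
  rewrite mulrA [leRHS]mulrC ler_wpM2r ?dot_ge0// -ler_pdivlMr//.
  rewrite ge_min; apply/orP; left; rewrite le_eqVlt; apply/orP; left.
  by apply/eqP; field; exact: lt0r_neq0.
have lp : lam * quadform Pm e <= eps / tau * dot e e.
  apply: (@le_trans _ _ (lam * (p * dot e e))); first by rewrite ler_pM2l.
  rewrite mulrA ler_wpM2r ?dot_ge0// -ler_pdivlMr//.
  by rewrite ge_min lexx orbT.
have {}bnd : 2 * (dot x (S *m (Mx *m h)) + dot e (Pm *m h)) <=
    kappa * dot x x - eps * dot e e.
  have := dot_ge0 del => d0; have := mulr_ge0 (ltW eps0) d0; lra.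
have tk : tau^-1 * kappa <= 1 / 2 by rewrite ler_pdivrMl//; lra.
have xk : tau^-1 * kappa * dot x x <= 1 / 2 * dot x x by rewrite ler_wpM2r ?dot_ge0.
have tb : tau^-1 * (2 * (dot x (S *m (Mx *m h)) + dot e (Pm *m h))) <=
    tau^-1 * (kappa * dot x x - eps * dot e e) by rewrite ler_pM2l ?invr_gt0.
have := lyap x; lra.
Qed.
End ClosedLoop.

(** * The theorem *)

Theorem mainTheorem3 (R : realType) (n m r nw nc q : nat)
  (* plant *)
  (A : 'M[R]_n) (B : 'M[R]_(n, m)) (Bw : 'M[R]_(n, nw))
  (C : 'M[R]_(r, n)) (D : 'M[R]_(r, m)) (Dw : 'M[R]_(r, nw))
  (W : set 'cV[R]_nw)
  (* steady-state problem *)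
  (U : set 'cV[R]_m) (f0 : 'cV[R]_m -> \bar R)
  (Zs : set 'cV[R]_r) (g0 : 'cV[R]_r -> \bar R)
  (Hz : 'M[R]_(nc, r)) (Hu : 'M[R]_(nc, m)) (Hw : 'M[R]_(nc, nw))
  (* the matrix T, the cost splitting, the multipliers *)
  (T : 'M[R]_(r + m, q))
  (Q1 : 'M[R]_m) (ft : 'cV[R]_m -> R) (Q2 : 'M[R]_r) (gt : 'cV[R]_r -> R)
  (Theta1 : 'M[R]_(m + m)) (Theta2 : 'M[R]_(r + r))
  (rho gamma : R)
  (* LMI variables *)
  (Y : 'M[R]_(q + nc)) (Z : 'M[R]_(m, q + nc)) (theta1 theta2 : R) :
  let P := Plant A B Bw C D Dw in
  let pb := SteadyProblem U f0 Zs g0 Hz Hu Hw in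
  let Gu := dcgain_u P in
  let Gw := dcgain_w P in
  let Tz := usubmx T in
  let Tu := dsubmx T in
  let N := Hz *m Gu + Hu in
  let Nt := Hz *m Gw + Hw in
  let Q := Tu^T *m Q1 + Tz^T *m Q2 *m Gu in
  let cA : 'M[R]_(q + nc) := 0 in
  let cB : 'M[R]_(q + nc, m) := col_mx (- Q) (- N) in
  let cB1 : 'M[R]_(q + nc, m + r) := block_mx (- Tu^T) (- Tz^T) 0 0 in
  let cB2 : 'M[R]_(q + nc, nw) := col_mx (- (Tz^T *m Q2 *m Gw)) (- Nt) in
  let cC1 : 'M[R]_(m + r, q + nc) := 0 in
  let cE1 : 'M[R]_(m + r, m) := col_mx 1%:M Gu in
  let cD1 : 'M[R]_(m + r) := 0 in
  let cD12 : 'M[R]_(m + r, nw) := col_mx 0 Gw in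
  let cC2 : 'M[R]_(q + nc) := 0 in
  let cE2 : 'M[R]_(q + nc, m) := col_mx (- Q) (- (rho *: N)) in
  let cD21 : 'M[R]_(q + nc, m + r) := block_mx (- Tu^T) (- Tz^T) 0 0 in
  let cD2 : 'M[R]_(q + nc, nw) :=
    col_mx (- (Tz^T *m Q2 *m Gw)) (- (rho *: Nt)) in
  let Theta := daug (theta1^-1 *: Theta1) (theta2^-1 *: Theta2) in
  let M : 'M[R]_(((q + nc) + (q + nc)) +
                 (((m + r) + (m + r)) + (nw + (q + nc))),
                 (q + nc) + ((m + r) + (q + nc))) :=
    col_mx
      (col_mx
        (row_mx (- (cA *m Y + cB *m Z)^T)
          (row_mx (- (cC1 *m Y + cE1 *m Z)^T) (- (cC2 *m Y + cE2 *m Z)^T)))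
        (row_mx 1%:M (row_mx 0 0)))
      (col_mx
        (col_mx
          (row_mx (- cB1^T) (row_mx (- cD1^T) (- cD21^T)))
          (row_mx 0 (row_mx 1%:M 0)))
        (col_mx
          (row_mx (- cB2^T) (row_mx (- cD12^T) (- cD2^T)))
          (row_mx 0 (row_mx 0 1%:M)))) in
  let Pi :=
    bdiag (block_mx 0 (- 1%:M) (- 1%:M) 0 : 'M[R]_((q + nc) + (q + nc)))
      (bdiag (- invmx Theta)
        (bdiag (1%:M : 'M[R]_nw)
               (- (gamma ^+ 2)%:M : 'M[R]_(q + nc)))) in
  let K := Z *m invmx Y in
  (* standing assumptions *)
  hurwitz A ->
  @convex_set R 'cV[R]_nw W -> compact W ->
  convex_cost U f0 -> convex_cost Zs g0 ->
  (forall w, W w -> exists z u, strictly_feasible P pb w z u) ->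
  (* the optimum is one at which the gradients exist *)
  (forall w, W w -> exists z u, [/\ optimal P pb w z u, U° u & Zs° z]) ->
  (* range T = null [I, -Gu; Hz, Hu] *)
  (forall v : 'cV[R]_(r + m),
     (exists y : 'cV[R]_q, v = T *m y) <->
     block_mx 1%:M (- Gu) Hz Hu *m v = 0) ->
  cost_splitting U f0 Q1 ft -> cost_splitting Zs g0 Q2 gt ->
  class_multiplier U° ft Theta1 -> class_multiplier Zs° gt Theta2 ->
  0 < rho -> 0 < gamma ->
  (* the LMI *)
  posdef Y -> 0 < theta1 -> 0 < theta2 ->
  negdef (M^T *m Pi *m M) ->
  exists2 taustar : R, 0 < taustar & forall tau : R, taustar < tau ->
    solves_OSS P pb W
      (gradient_controller pb Tz Tu (lsubmx K) (rsubmx K) tau).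
Proof.
move=> P pb Gu Gw Tz Tu N Nt Q cA cB cB1 cB2 cC1 cE1 cD1 cD12 cC2 cE2 cD21 cD2 Theta M Pi K.
move=> hA _ _ cf cg _ opt rangeT sf sg mf mg rho0 gamma0 Yp th1 th2 neg.
have [S [Sp lyap]] := hurwitz_lyapunov hA.
have Au : A \in unitmx.
  apply: injmx_unit => v Av; apply/eqP; rewrite -dot_eq0; apply/eqP/le_anti.
  by have := lyap v; rewrite Av mulmx0 dot0r mulr0 oppr_ge0 dot_ge0 andbT.
have bal1 : balanced_multiplier (theta1^-1 *: Theta1).
  by apply: balanced_scale; [rewrite invr_gt0 | exact: class_balanced mf].
have bal2 : balanced_multiplier (theta2^-1 *: Theta2).
  by apply: balanced_scale; [rewrite invr_gt0 | exact: class_balanced mg].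
have [Ths Thu Thn] := daug_balanced bal1 bal2.
have KY : K *m Y = Z by rewrite /K mulmxKV// posdef_unit.
pose Pm := invmx Y.
have primal e del : (e != 0) || (del != 0) ->
    2 * dot e (Pm *m (cB *m K *m e + cB1 *m del))
      + quadform Theta (col_mx del (cE1 *m K *m e)) < 0.
  apply: primal_of_dual => // a b ab.
  have := lmi_dual neg ab.
  have -> : - (cA *m Y + cB *m Z)^T *m a + - (cC1 *m Y + cE1 *m Z)^T *m b =
      - (Y *m ((cB *m K)^T *m a + (cE1 *m K)^T *m b)).
    rewrite !mul0mx !add0r -KY !mulmxA !trmx_mul (proj1 Yp).
    by rewrite mulmxDr !mulmxA opprD !mulNmx.
  have -> : - cB1^T *m a + - cD1^T *m b = - (cB1^T *m a).
    by rewrite /cD1 trmx0 oppr0 mul0mx addr0 mulNmx.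
  by rewrite dotNl mulrN mulNr.
have sector u u' z z' : U° u -> U° u' -> Zs° z -> Zs° z' ->
    0 <= quadform Theta (col_mx (residual ft gt z z' u u') (col_mx (u - u') (z - z'))).
  move=> Uu Uu' Zz Zz'; rewrite /residual daug_quadform !quadformE -!scalemxAl !dotZr.
  rewrite -!quadformE addr_ge0// mulr_ge0 ?invr_ge0 ?(ltW th1) ?(ltW th2)//.
    exact: (class_sector (cost_dom_convex cf) (split_diff sf) mf Uu' Uu).
  exact: (class_sector (cost_dom_convex cg) (split_diff sg) mg Zz' Zz).
have TE : T = col_mx Tz Tu by rewrite vsubmxK.
have nullE (a : 'cV[R]_r) (b : 'cV[R]_m) :
    block_mx 1%:M (- Gu) Hz Hu *m col_mx a b = 0 <->
    a = Gu *m b /\ Hz *m a + Hu *m b = 0.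
  rewrite mul_block_col mul1mx mulNmx -[X in _ = X]col_mx0; split.
    by move=> /eq_col_mx[/eqP]; rewrite subr_eq0 => /eqP.
  by move=> [-> ->]; rewrite subrr.
have dirs (y : 'cV[R]_q) : Tz *m y = Gu *m (Tu *m y) /\
    Hz *m (Tz *m y) + Hu *m (Tu *m y) = 0.
  by apply/nullE; rewrite -mul_col_mx -TE; apply/rangeT; exists y.
have NTu (u : 'cV[R]_m) : (exists y : 'cV[R]_q, u = Tu *m y) <-> N *m u = 0.
  split=> [[y ->]|Nu].
    by have [d1 d2] := dirs y; rewrite /N mulmxDl -mulmxA -d1.
  have /rangeT[y] : block_mx 1%:M (- Gu) Hz Hu *m col_mx (Gu *m u) u = 0.
    by apply/nullE; split=> //; rewrite mulmxA -mulmxDl.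
  by rewrite TE mul_col_mx => /eq_col_mx[_ uE]; exists y.
have TzE : Tz = Gu *m Tu.
  apply/matrixP => i j; have [/matrixP/(_ i 0) + _] := dirs (delta_mx j 0).
  by rewrite mulmxA -!colE !mxE.
have [g1 Hg1] := mult_gain bal1; have [g2 Hg2] := mult_gain bal2.
pose Hs := Q1 + g1%:M + Gu^T *m (Q2 + g2%:M) *m Gu.
(* On the disturbance produced by the scalar gains of the sectors, the sector form
   is nonnegative, so that the strict inequality keeps [B K e + B1 del] from
   vanishing. *)
have Ksurj : forall u : 'cV[R]_m, exists eta, K *m eta = u.
  apply: (@gain_surjective R m q nc K Tu Hs N NTu) => e e0.
  apply/eqP => He; pose v := K *m e.
  have := primal e (col_mx (g1 *: v) (g2 *: (Gu *m v))); rewrite e0 => /(_ isT).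
  have -> : cB *m K *m e + cB1 *m col_mx (g1 *: v) (g2 *: (Gu *m v)) = 0.
    have -> : 0 = - (col_mx (Tu^T *m Hs) N *m v) by rewrite /v He oppr0.
    rewrite -mulmxA -/v /cB /cB1 mul_block_col !mul_col_mx !mul0mx addr0 add_col_mx opp_col_mx.
    rewrite addr0 mulNmx; congr col_mx; last by rewrite mulNmx.
    rewrite /Q /Hs TzE.
    exact: multiplier_gain.
  rewrite mulmx0 dot0r mulr0 add0r -mulmxA -/v mul_col_mx mul1mx daug_quadform.
  by rewrite ltNge addr_ge0// ?Hg1 ?Hg2.
have [kappa [eps [kappa0 eps0 bound]]] := @slow_fast_bound R n (q + nc) (m + r) Pm
  (cB *m K) cB1 (col_mx (- (Tz^T *m Q2 *m C)) (- (Hz *m C))) (cE1 *m K)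
  (col_mx 0 C) Theta (S *m (invmx A *m B *m K)) primal.
exists (2 * kappa) => [|tau tauk w Ww]; first by rewrite mulr_gt0.
have tau0 : 0 < tau by apply: lt_trans tauk; rewrite mulr_gt0.
have [z [u [zu_opt Uu Zz]]] := opt w Ww.
have stat := @optimal_stationary R n m r nw nc q P pb w z u Tz Tu
  cf cg zu_opt Uu Zz dirs.
have [[_ _ zE conE] _] := zu_opt.
have [eta etaE] := Ksurj u.
have [eqxi zxi uxi] := loop_equilibrium tau Au Uu Zz zE (esym conE) stat etaE.
set xi := col_mx _ eta in eqxi zxi uxi.
exists xi; split=> //.
- move=> xi'; apply: (equilibrium_unique Au sf sg primal sector (lt0r_neq0 tau0) eqxi).
- exact: (loop_stable Au sf sg sector cf cg Sp lyap (posdef_inv Yp) kappa0 eps0 bound tauk eqxi).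
- by rewrite zxi uxi.
Qed.
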